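(* Suppose Assumption 2 (stated in the context) is satisfied. Then $-\tilde{T}_{m,p}$ and $\tilde{V}_{m,p}$ have the same distribution, and $$\tilde{Z}'_p:=\tilde{V}_{m,p}+2\sqrt{m\log p}\;\to\;0$$ in probability as $n\to\infty$ (so that $p=p_n\to\infty$). Furthermore, $$\lim_{p\to\infty}\mathbb{E}\left[e^{\alpha|\tilde{Z}'_p|}\mathbf{1}_{\{|\tilde{Z}'_p|\geq\delta\}}\right]=0$$ for all $\alpha>0$ and $\delta>0$.
   Context: Let $p=p_n\to\infty$ as $n\to\infty$, and let $m$ be an integer, $2\le m\le p$, possibly depending on $n$ through $p$. Let $\tilde{W}=(\tilde{w}_{ij})_{1\le i,j\le p}$ be a symmetric random matrix whose entries $\tilde w_{ij}$, $i\le j$, are independent with $\tilde{w}_{ii}\sim N(0,2)$ and $\tilde{w}_{ij}\sim N(0,1)$ for $i<j$. For $S\subset\{1,\dots,p\}$ let $\tilde{W}_S=(\tilde{w}_{ij})_{i,j\in S}$. For an $m\times m$ symmetric matrix $A$, $\lambda_1(A)$ and $\lambda_m(A)$ denote its largest and smallest eigenvalues. Define $$\tilde{T}_{m,p}=\max_{S\subset\{1,\dots,p\},\,|S|=m}\lambda_1(\tilde{W}_S),\qquad \tilde{V}_{m,p}=\min_{S\subset\{1,\dots,p\},\,|S|=m}\lambda_m(\tilde{W}_S).$$ Assumption 2: either $m\ge2$ is fixed, or $m\to\infty$ with $m=o\left(\frac{(\log p)^{1/3}}{\log\log p}\right)$. *)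

(* Defs.v *)
From HB Require Import structures.
From mathcomp Require Import all_boot all_order all_algebra.
From mathcomp Require Import all_classical all_reals all_analysis.
Set Implicit Arguments.
Unset Strict Implicit.
Unset Printing Implicit Defensive.
Import Order.TTheory GRing.Theory Num.Theory.
Import numFieldNormedType.Exports.
Local Open Scope classical_set_scope.
Local Open Scope ring_scope.

(* A real symmetric matrix of positive size has a nonempty finite set of real
   eigenvalues, so that the supremum and the infimum below are attained. *)
Definition lambda_max (R : realType) (k : nat) (A : 'M[R]_k) : R :=
  sup [set a : R | eigenvalue A a].

Definition lambda_min (R : realType) (k : nat) (A : 'M[R]_k) : R :=
  inf [set a : R | eigenvalue A a].

(* Rows and columns are listed in increasing order of their index in [S]. *)
Definition principal_submx (R : realType) (p : nat) (A : 'M[R]_p)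
    (S : {set 'I_p}) : 'M[R]_#|S| :=
  mxsub enum_val enum_val A.

(* For [m <= p] these are the maximum and the minimum of a nonempty finite
   set of reals. *)
Definition max_lambda (R : realType) (m p : nat) (A : 'M[R]_p) : R :=
  sup [set lambda_max (principal_submx A S) | S in
        [set S : {set 'I_p} | #|S| = m]].

Definition min_lambda (R : realType) (m p : nat) (A : 'M[R]_p) : R :=
  inf [set lambda_min (principal_submx A S) | S in
        [set S : {set 'I_p} | #|S| = m]].

Definition mutually_independent (d : measure_display) (T : measurableType d)
    (R : realType) (P : probability T R) (I : finType)
    (X : I -> {RV P >-> R}) : Prop :=
  forall (J : {set I}) (B : I -> set R), (forall i, measurable (B i)) ->
    P (\bigcap_(i in [set` J]) (X i @^-1` B i)) =
    (\prod_(i in J) P (X i @^-1` B i))%E.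

(* [X] has law N(mu, v): [normal_prob] is parameterized by the standard
   deviation, not by the variance.  Laws are only compared on Borel sets. *)
Definition has_normal_law (d : measure_display) (T : measurableType d)
    (R : realType) (P : probability T R) (X : {RV P >-> R}) (mu v : R) : Prop :=
  forall B : set R, measurable B ->
    distribution P X B = normal_prob mu (Num.sqrt v) B.

Definition gaussian_wigner (d : measure_display) (T : measurableType d)
    (R : realType) (P : probability T R) (p : nat)
    (W : 'I_p -> 'I_p -> {RV P >-> R}) : Prop :=
  [/\ forall i j w, W i j w = W j i w,
      mutually_independent
        (fun ij : {ij : 'I_p * 'I_p | (ij.1 <= ij.2)%N} =>
           W (val ij).1 (val ij).2),
      forall i, has_normal_law (W i i) 0 2
    & forall i j : 'I_p, (i < j)%N -> has_normal_law (W i j) 0 1].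

Definition random_mx (d : measure_display) (T : measurableType d)
    (R : realType) (P : probability T R) (p : nat)
    (W : 'I_p -> 'I_p -> {RV P >-> R}) (w : T) : 'M[R]_p :=
  \matrix_(i, j) W i j w.

(* Having a law presupposes being a random variable, hence the measurability
   clauses. *)
Definition same_distribution (d : measure_display) (T : measurableType d)
    (R : realType) (P : probability T R) (X Y : T -> R) : Prop :=
  [/\ measurable_fun setT X, measurable_fun setT Y
    & forall B : set R, measurable B -> P (X @^-1` B) = P (Y @^-1` B)].

(* The [n]-th variable may live on its own probability space. *)
Definition cvg_in_probability0 (R : realType) (d : nat -> measure_display)
    (T : forall n, measurableType (d n)) (P : forall n, probability (T n) R)
    (X : forall n, T n -> R) : Prop :=
  forall e : R, 0 < e ->
    P n [set w | e <= `|X n w|] @[n --> \oo] --> 0%E.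

(* [m] is a function of [p]; all limits are along the sequence [p n]. *)
Definition assumption2 (R : realType) (p m : nat -> nat) : Prop :=
  (exists2 k, (2 <= k)%N & forall n, m (p n) = k) \/
  ((fun n => m (p n)) @ \oo --> \oo /\
   (fun n => (m (p n))%:R : R) =o_\oo
   (fun n => ln ((p n)%:R : R) `^ (3%:R)^-1 / ln (ln ((p n)%:R : R)))).

(* Main.v *)
(* Replacing W by -W turns the minimum V into -T, so only T matters.  Write
   L = ln p and M = sqrt (m L); the claim is that T concentrates at 2 M.

   Upper side: for a vector u the quadratic form u W u^T is N(0, 2 |u|^4).  Rounding
   a top eigenvector to a grid of mesh 1/K bounds e^(M T) by a sum of at most
   2 C(p, m) (2 K + 1)^m exponentials of Gaussians, whence E e^(M (T - 2 M)) = e^o(M).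

   Lower side: T dominates G_S = (1/m) sum_(i, j in S) W_ij ~ N(0, 2) for all S, and
   Cov (G_S, G_S') = 2 (|S n S'| / m)^2.  Chebyshev's inequality applied to the number
   of S with G_S >= 2 M - s gives P (T < 2 M - s) <= e^(- s M / 10) for large M.

   Both tails decay at an exponential rate of order M, which beats the factor
   e^(alpha |Z|); where T is very small, |Z| is at most 2 M plus the absolute value
   of a single G_S.

   The growth assumption enters through m^3 <= L, which makes the entropy terms
   m ln M negligible with respect to M. *)

Require Import Defs.
From HB Require Import structures.
From mathcomp Require Import all_boot all_order all_algebra.
From mathcomp Require Import all_classical all_reals all_analysis.
From mathcomp Require Import measurable_realfun normal_distribution ring lra.
Import Order.TTheory GRing.Theory Num.Theory.
Import numFieldNormedType.Exports.
Local Open Scope classical_set_scope.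
Local Open Scope ring_scope.
Set Implicit Arguments.
Unset Strict Implicit.
Unset Printing Implicit Defensive.

(** * Gaussian laws *)

(** The slope M in the exponential moment is forced. There are at most e^(M^2) sets S, and the form
    of a unit vector is N(0, 2), so slope b leads to the bound e^(M^2 + b^2 - 2 b M) = e^((M - b)^2)
    for E e^(b (T - 2 M)): only b = M cancels the leading terms, and then any factor e^o(M) may be
    lost. The same count explains why G_S is enough below: about e^(M^2) weakly dependent N(0, 2)
    variables already reach 2 M, so the choice of the unit vector inside a submatrix is not felt at
    leading order.

    Rounding an eigenvector would ordinarily call for a bound on the operator norm. Here the
    quadratic error is controlled by the top eigenvalues of W and of - W, whichever is larger; this
    is why exponentials of both signs are summed, and where the factor 2 comes from.

    All estimates become polynomial inequalities in u = M^(1/4): there are at most e^(u^8) sets, m^3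
    <= L gives m <= u^2, and since ln u <= u the entropy terms are at most of order u^3, against M =
    u^4. *)

Lemma lebesgue_measure_affine (R : realType) (a b : R) (B : set R) :
  a != 0 -> measurable B ->
  lebesgue_measure B =
  (`|a|%:E * lebesgue_measure ((fun x => a * x + b)%R @^-1` B))%E.
Proof.
move=> a0 mB.
have mf : measurable_fun [set: R] (fun x : R => a * x + b).
  by apply: measurable_funD => //; exact: measurable_funM.
pose f := fun x : R => a * x + b.
pose nu := measure_function_pushforward__canonical__measure_function_Measure
  (@lebesgue_measure R) (mf : measurable_fun _ (f : _ -> measurableTypeR R)).
pose mu : {measure set (measurableTypeR R) -> \bar R} :=
  mscale (NngNum (normr_ge0 a)) nu.
(* Lebesgue measure is determined by half-open intervals, so only the preimages of []x, y]] have to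
   be measured; for negative [a] the closed end moves to the left. *)
rewrite [LHS](@lebesgue_measure_unique R mu)//.
move=> _ [[x y] _ <-] /=.
rewrite /mu /mscale /= /pushforward.
have [xy|yx] := ltP x y; last first.
  rewrite set_itv_ge ?bnd_simp -?leNgt// preimage_set0 !measure0 mule0//.
rewrite lebesgue_measure_itv/= lte_fin xy.
have [a_gt0|a_lt0|/eqP] := ltgtP 0 a; last by rewrite eq_sym (negbTE a0).
- rewrite (_ : _ @^-1` _ = `](x - b) / a, (y - b) / a]%classic); last first.
    apply/seteqP; split=> z /=; rewrite !in_itv/= ltr_pdivrMr// ler_pdivlMr//;
    by rewrite ltrBlDr lerBrDr (mulrC z).
  rewrite lebesgue_measure_itv/= lte_fin ltr_pM2r ?invr_gt0// ltrD2r xy.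
  by rewrite gtr0_norm// -!EFinD -EFinM; congr EFin; field.
- rewrite (_ : _ @^-1` _ = `[(y - b) / a, (x - b) / a[%classic); last first.
    apply/seteqP; split=> z /=; rewrite !in_itv/= ler_ndivrMr// ltr_ndivlMr//;
    by rewrite ltrBlDr lerBrDr (mulrC z) andbC.
  rewrite lebesgue_measure_itv/= lte_fin ltr_nM2r ?invr_lt0// ltrD2r xy.
  by rewrite ltr0_norm// -!EFinD -EFinM; congr EFin; field; rewrite lt_eqF.
Qed.

Lemma normal_pdf_sqr (R : realType) (m s t x : R) : s ^+ 2 = t ^+ 2 -> s != 0 ->
  normal_pdf m s x = normal_pdf m t x.
Proof.
move=> st s0; have t0 : t != 0 by rewrite -sqrf_eq0 -st sqrf_eq0.
by rewrite !normal_pdfE// /normal_peak /normal_fun st.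
Qed.

Lemma normal_prob_sqr (R : realType) (m s t : R) (B : set R) :
  s ^+ 2 = t ^+ 2 -> s != 0 -> normal_prob m s B = normal_prob m t B.
Proof. by move=> st s0; apply: eq_integral => x _; rewrite (normal_pdf_sqr _ _ st). Qed.

(** The change of variables is made with the Radon-Nikodym derivative, which equals the density
    almost everywhere because both have the same integral over every measurable set. *)
Lemma integral_normal_prob (R : realType) (m s : R) (f : R -> \bar R) :
  measurable_fun setT f -> (forall x, 0 <= f x)%E ->
  (\int[normal_prob m s]_x f x =
   \int[lebesgue_measure]_x (f x * (normal_pdf m s x)%:E))%E.
Proof.
move=> mf f0.
rewrite -(Radon_Nikodym_SigmaFinite.change_of_variables
  (normal_prob_dominates m s) f0 measurableT mf).
apply: ae_eq_integral => //.
- apply: emeasurable_funM => //.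
  exact: measurable_int (Radon_Nikodym_SigmaFinite.f_integrable
    (normal_prob_dominates m s)).
- apply: emeasurable_funM => //; apply/measurable_EFinP.
  exact: measurable_normal_pdf.
- apply: ae_eqe_mul2l; apply: integral_ae_eq => //.
  + exact: (Radon_Nikodym_SigmaFinite.f_integrable (normal_prob_dominates m s)).
  + by apply/measurable_EFinP; exact: measurable_normal_pdf.
  + move=> A _ mA; rewrite -Radon_Nikodym_SigmaFinite.f_integral//.
    exact: normal_prob_dominates.
Qed.

Lemma normal_pdf_affine (R : realType) (m s a b x : R) : a != 0 -> s != 0 ->
  `|a| * normal_pdf (a * m + b) (a * s) (a * x + b) = normal_pdf m s x.
Proof.
move=> a0 s0; rewrite !normal_pdfE ?mulf_neq0// mulrA; congr (_ * _).
- rewrite /normal_peak exprMn -mulrA -mulrnAr sqrtrM ?sqr_ge0//.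
  by rewrite sqrtr_sqr invfM mulrA mulfV ?mul1r// normr_eq0.
- rewrite /normal_fun; congr expR.
  by field; rewrite a0 s0.
Qed.

Lemma normal_prob_affine (R : realType) (m s a b : R) (B : set R) :
  a != 0 -> s != 0 -> measurable B ->
  normal_prob m s ((fun x => a * x + b) @^-1` B) =
  normal_prob (a * m + b) (a * s) B.
Proof.
move=> a0 s0 mB.
have mf : measurable_fun [set: R] (fun x : R => a * x + b).
  by apply: measurable_funD => //; exact: measurable_funM.
pose f := fun x : R => a * x + b.
pose nu := measure_function_pushforward__canonical__measure_function_Measure
  (@lebesgue_measure R) (mf : measurable_fun _ (f : _ -> measurableTypeR R)).
pose mu : {measure set (measurableTypeR R) -> \bar R} :=
  mscale (NngNum (normr_ge0 a)) nu.
have mpdf n t D : measurable_fun D (fun x : R => (normal_pdf n t x)%:E).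
  by apply/measurable_EFinP; apply: measurable_funTS; exact: measurable_normal_pdf.
rewrite [RHS](eq_measure_integral mu); last first.
  by move=> A mA _; exact: lebesgue_measure_affine.
rewrite ge0_integral_mscale//; [|exact: mpdf|]; last first.
  by move=> *; rewrite lee_fin normal_pdf_ge0.
rewrite [X in (_ * X)%E](@ge0_integral_pushforward
  _ _ (measurableTypeR R) (measurableTypeR R) R f
  mf lebesgue_measure)//; [|exact: mpdf|]; last first.
  by move=> *; rewrite lee_fin normal_pdf_ge0.
rewrite -ge0_integralZl//=; last 3 first.
- by rewrite -[_ @^-1` _]setTI; exact: (mf measurableT _ mB).
- apply/measurable_EFinP; apply: measurable_funTS.
  by apply: measurableT_comp => //; exact: measurable_normal_pdf.
- by move=> *; rewrite lee_fin normal_pdf_ge0.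
by apply: eq_integral => x _; rewrite -EFinM normal_pdf_affine.
Qed.

(** Completing the square. The left side is the joint density of a first summand [x] and the sum
    [z]; the right side is the density of [z] times the conditional density of [x] given [z].
    Integrating [x] out leaves the law of the sum. *)
Lemma normal_pdf_convolution (R : realType) (s t r x z : R) :
  s != 0 -> t != 0 -> r ^+ 2 = s ^+ 2 + t ^+ 2 ->
  normal_pdf 0 s x * normal_pdf x t z =
  normal_pdf 0 r z * normal_pdf (s ^+ 2 / r ^+ 2 * z) (s * t / r) x.
Proof.
move=> s0 t0 r2.
have s2 : 0 < s ^+ 2 by rewrite exprn_even_gt0.
have t2 : 0 < t ^+ 2 by rewrite exprn_even_gt0.
have r0 : r != 0 by rewrite -sqrf_eq0 r2 gt_eqF// addr_gt0.
rewrite !normal_pdfE ?mulf_neq0 ?invr_eq0// /normal_peak /normal_fun.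
have q (v : R) : 0 <= v ^+ 2 * pi *+ 2.
  by rewrite mulrn_wge0// mulr_ge0 ?sqr_ge0 ?pi_ge0.
rewrite mulrACA [RHS]mulrACA -!expRD -!invfM -!sqrtrM//.
congr (_ * _).
  congr ((Num.sqrt _)^-1); field; exact: r0.
congr expR.
have d0 : s ^+ 2 + t ^+ 2 != 0 by rewrite gt_eqF// addr_gt0.
rewrite !exprMn !exprVn r2; field.
by rewrite d0 t0 s0.
Qed.

Lemma normal_prob_convolution (R : realType) (s t r : R) (B : set R) :
  s != 0 -> t != 0 -> r ^+ 2 = s ^+ 2 + t ^+ 2 -> measurable B ->
  (\int[normal_prob 0 s]_x normal_prob x t B = normal_prob 0 r B)%E.
Proof.
move=> s0 t0 r2 mB.
have mtr : measurable_fun setT (fun z : R * R => normal_pdf z.1 t z.2).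
  rewrite (_ : (fun _ => _) = (normal_pdf 0 t) \o (fun z : R * R => z.2 - z.1)).
    apply: measurableT_comp; first exact: measurable_normal_pdf.
    by apply: measurable_funB; [exact: measurable_snd|exact: measurable_fst].
  apply/funext => z /=; rewrite !normal_pdfE// /normal_fun.
  by rewrite subr0.
pose f (z : R * R) : \bar R :=
  (normal_pdf 0 s z.1 * normal_pdf z.1 t z.2 * \1_B z.2)%:E.
have mf : measurable_fun setT f.
  apply/measurable_EFinP; apply: measurable_funM.
    apply: measurable_funM => //.
    by apply: measurableT_comp; [exact: measurable_normal_pdf|exact: measurable_fst].
  by apply: measurableT_comp; [exact: measurable_indic|exact: measurable_snd].
have f0 z : (0 <= f z)%E by rewrite lee_fin !mulr_ge0 ?normal_pdf_ge0.
have mpdf m v : measurable_fun setT (fun z : R => (normal_pdf m v z)%:E).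
  by apply/measurable_EFinP; exact: measurable_normal_pdf.
have pdf0 m v (z : R) : (0 <= (normal_pdf m v z)%:E)%E by rewrite lee_fin normal_pdf_ge0.
have E x : normal_prob x t B = (\int[lebesgue_measure]_z
    (normal_pdf x t z * \1_B z)%:E)%E.
  rewrite /normal_prob integral_mkcond; apply: eq_integral => z _ /=.
  rewrite patchE indicE; case: (z \in B) => /=; by rewrite ?mulr1 ?mulr0.
have mc x : measurable_fun [set: R] (fun z : R => (normal_pdf x t z * \1_B z)%:E).
  apply/measurable_EFinP; apply: measurable_funM.
  - exact: measurable_normal_pdf.
  - exact: measurable_indic.
transitivity (\int[lebesgue_measure]_x \int[lebesgue_measure]_z f (x, z))%E.
  rewrite integral_normal_prob.
  - apply: eq_integral => x _; rewrite E muleC -ge0_integralZl//.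
    + by apply: eq_integral => z _; rewrite /f /= -EFinM mulrA.
    + exact: mc.
    + by move=> z _; rewrite lee_fin mulr_ge0 ?normal_pdf_ge0.
  - rewrite (_ : (fun x => normal_prob x t B) =
      fun x => (\int[lebesgue_measure]_z (normal_pdf x t z * \1_B z)%:E)%E);
      last exact/funext.
    move: E => _.
    pose g (z : R * R) := (normal_pdf z.1 t z.2 * \1_B z.2)%:E.
    change (measurable_fun setT (fubini_F lebesgue_measure g)).
    apply: measurable_fun_fubini_tonelli_F.
      apply/measurable_EFinP; apply: measurable_funM => //.
      by apply: measurableT_comp; [exact: measurable_indic|exact: measurable_snd].
    by move=> z; rewrite lee_fin mulr_ge0 ?normal_pdf_ge0.
  - by move=> x; rewrite integral_ge0.
rewrite (@fubini_tonelli _ _ (measurableTypeR R) (measurableTypeR R) R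
  lebesgue_measure lebesgue_measure f mf f0).
rewrite /normal_prob [RHS]integral_mkcond; apply: eq_integral => z _ /=.
rewrite patchE /f /= indicE; case: (z \in B) => /=.
  under eq_integral do rewrite mulr1 (normal_pdf_convolution _ _ s0 t0 r2) EFinM.
  rewrite ge0_integralZl//; last exact: mpdf.
  by rewrite integral_normal_pdf mule1.
by under eq_integral do rewrite mulr0; rewrite integral0.
Qed.

Lemma normal_sum (R : realType) (d : measure_display) (T : measurableType d)
    (P : probability T R) (X Y : T -> R) (s t r : R) :
  measurable_fun setT X -> measurable_fun setT Y ->
  (forall A B, measurable A -> measurable B ->
    P (X @^-1` A `&` Y @^-1` B) = (P (X @^-1` A) * P (Y @^-1` B))%E) ->
  s != 0 -> t != 0 -> r ^+ 2 = s ^+ 2 + t ^+ 2 ->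
  (forall B, measurable B -> P (X @^-1` B) = normal_prob 0 s B) ->
  (forall B, measurable B -> P (Y @^-1` B) = normal_prob 0 t B) ->
  forall B, measurable B ->
    P ((fun w => X w + Y w) @^-1` B) = normal_prob 0 r B.
Proof.
move=> mX mY indXY s0 t0 r2 PX PY B mB.
pose RR := (measurableTypeR R * measurableTypeR R)%type.
have mXY : measurable_fun setT ((fun w => (X w, Y w)) : T -> RR).
  exact/measurable_fun_pair.
pose mXY_mixin := isMeasurableFun.Build _ _ _ _ _ mXY.
pose XY : {mfun T >-> RR} := HB.pack ((fun w => (X w, Y w)) : T -> RR) mXY_mixin.
pose S := [set z : RR | B (z.1 + z.2 : R)].
have mS : measurable S.
  rewrite -[S]setTI.
  have mD : measurable_fun setT (fun z : RR => (z.1 : R) + z.2).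
    by apply: measurable_funD; [exact: measurable_fst|exact: measurable_snd].
  exact: mD.
(* Independence is known on products of Borel sets only; uniqueness of the product measure extends
   it to [S], the set of pairs whose sum lies in [B]. *)
have PE := @product_measure_unique _ _ _ _ R (normal_prob 0 s) (normal_prob 0 t)
  (distribution P XY).
transitivity (distribution P XY S); first by [].
rewrite -PE//; last first.
  move=> A C mA mC; rewrite -[RHS](congr2 _ (PX _ mA) (PY _ mC)) -indXY//.
rewrite -(normal_prob_convolution s0 t0 r2 mB).
apply: eq_integral => x _ /=.
have -> : xsection S x = (fun y => 1 * y + x) @^-1` B.
  by apply/seteqP; split=> y; rewrite /xsection /S /= inE/= mul1r addrC.
by rewrite normal_prob_affine ?oner_eq0// mulr0 add0r mul1r.
Qed.

(** * Independence of groups of variables *)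

(** For fixed [C], both sides are finite measures in [A], so agreement on a pi-system spreads to the
    sigma-algebra that it generates. *)
Lemma pi_system_indep_left (R : realType) (d : measure_display)
    (T : measurableType d) (P : probability T R) (G : set (set T)) (C : set T) :
  setI_closed G -> G setT -> G `<=` measurable -> measurable C ->
  (forall A, G A -> P (A `&` C) = (P A * P C)%E) ->
  forall A, <<s G >> A -> P (A `&` C) = (P A * P C)%E.
Proof.
move=> GI GT Gm mC indG A GA.
have PC_ge0 : 0 <= fine (P C) by rewrite fine_ge0.
pose c := NngNum PC_ge0.
have cE : c%:num%:E = P C by rewrite fineK// fin_num_measure.
have E : forall A, G A -> mrestr P mC A = mscale c P A.
  by move=> B GB; rewrite /mrestr /mscale cE muleC indG.
transitivity (mscale c P A); last by rewrite /mscale cE muleC.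
apply: (g_sigma_algebra_measure_unique G Gm (fun=> setT) (fun=> GT) _ _ _ GI E) => //.
- by apply/seteqP; split=> // w _; exists 0%N.
- move=> k; apply: le_lt_trans (ltry 1).
  by apply: probability_le1; exact: measurableI.
Qed.

Lemma pi_system_indep (R : realType) (d : measure_display)
    (T : measurableType d) (P : probability T R) (G H : set (set T)) :
  setI_closed G -> G setT -> G `<=` measurable ->
  setI_closed H -> H setT -> H `<=` measurable ->
  (forall A C, G A -> H C -> P (A `&` C) = (P A * P C)%E) ->
  forall A C, <<s G >> A -> <<s H >> C -> P (A `&` C) = (P A * P C)%E.
Proof.
move=> GI GT Gm HI HT Hm indGH A C GA HC.
have sm (K : set (set T)) : K `<=` measurable -> <<s K >> `<=` measurable.
  by move=> Km; apply: smallest_sub => //; exact: sigma_algebra_measurable.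
rewrite setIC muleC; apply: (pi_system_indep_left HI) => //.
  exact: sm GA.
move=> C' HC'; rewrite setIC muleC; apply: (pi_system_indep_left GI) => //.
  exact: Hm.
by move=> A' GA'; exact: indGH.
Qed.

(** A pi-system generating the sigma-algebra of the variables [X i] with [i] in [J], in the very
    form in which mutual independence is stated. *)
Definition rectangles (R : realType) (T : Type) (I : finType) (X : I -> T -> R)
    (J : {set I}) : set (set T) :=
  [set A | exists2 B : I -> set R, (forall i, measurable (B i)) &
    A = \bigcap_(i in [set` J]) (X i @^-1` B i)].

Lemma rectanglesT (R : realType) (T : Type) (I : finType) (X : I -> T -> R)
    (J : {set I}) : rectangles X J setT.
Proof. by exists (fun=> setT) => //; apply/seteqP; split. Qed.

Lemma rectangles_setI (R : realType) (T : Type) (I : finType) (X : I -> T -> R)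
    (J : {set I}) : setI_closed (rectangles X J).
Proof.
move=> _ _ [B mB ->] [C mC ->].
exists (fun i => B i `&` C i); first by move=> i; exact: measurableI.
by rewrite -bigcapI.
Qed.

Lemma rectangles_preimage (R : realType) (T : Type) (I : finType)
    (X : I -> T -> R) (J : {set I}) (i : I) (B : set R) :
  i \in J -> measurable B -> rectangles X J (X i @^-1` B).
Proof.
move=> iJ mB; exists (fun j => if j == i then B else setT).
  by move=> j; case: ifP.
apply/seteqP; split=> w.
  by move=> Bw j _ /=; case: eqP => // ->.
by move=> /(_ i iJ) /=; rewrite eqxx.
Qed.

Lemma rectangles_measurable (R : realType) (d : measure_display)
    (T : measurableType d) (I : finType) (X : I -> T -> R) (J : {set I}) :
  (forall i, measurable_fun setT (X i)) -> rectangles X J `<=` measurable.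
Proof.
move=> mX _ [B mB ->]; apply: fin_bigcap_measurable => //.
by move=> i _; rewrite -[_ @^-1` _]setTI; exact: mX.
Qed.

Lemma mutually_independent_groups (R : realType) (d : measure_display)
    (T : measurableType d) (P : probability T R) (I : finType)
    (X : I -> {RV P >-> R}) (J K : {set I}) (A C : set T) :
  mutually_independent X -> (forall i, i \in J -> i \notin K) ->
  <<s rectangles X J >> A -> <<s rectangles X K >> C ->
  P (A `&` C) = (P A * P C)%E.
Proof.
move=> indX JK; apply: pi_system_indep.
- exact: rectangles_setI.
- exact: rectanglesT.
- exact: rectangles_measurable.
- exact: rectangles_setI.
- exact: rectanglesT.
- exact: rectangles_measurable.
move=> _ _ [B mB ->] [D mD ->].
(* Since [J] and [K] are disjoint, the two families of Borel sets merge into one, to which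
   independence over the union of [J] and [K] applies. *)
pose E i := if i \in J then B i else D i.
have mE i : measurable (E i) by rewrite /E; case: ifP.
have KJ i : i \in K -> (i \in J) = false.
  by move=> iK; apply/negbTE/negP => /JK; rewrite iK.
have BE : \bigcap_(i in [set` J]) (X i @^-1` B i) =
    \bigcap_(i in [set` J]) (X i @^-1` E i).
  by apply: eq_bigcapr => i /= iJ; rewrite /E iJ.
have DE : \bigcap_(i in [set` K]) (X i @^-1` D i) =
    \bigcap_(i in [set` K]) (X i @^-1` E i).
  by apply: eq_bigcapr => i /= iK; rewrite /E KJ.
rewrite BE DE !indX// -bigcap_setU.
have -> : [set` J] `|` [set` K] = [set` (J :|: K)%SET].
  by apply/seteqP; split=> i /=; rewrite inE => /orP.
rewrite indX// (eq_bigl [predU (mem J) & (mem K)]); last first.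
  by move=> i; rewrite !inE.
rewrite bigU//; apply/pred0P => i /=; apply/negbTE/negP => /andP[/JK].
by move=> /negbTE ->.
Qed.

Lemma measurable_rectangles_comb (R : realType) (d : measure_display)
    (T : measurableType d) (I : finType) (X : I -> T -> R) (J : {set I})
    (a : I -> R) (B : set R) : measurable B ->
  <<s rectangles X J >> ((fun w => \sum_(i in J) a i * X i w) @^-1` B).
Proof.
move=> mB; rewrite -[_ @^-1` _]setTI.
pose T' := g_sigma_algebraType (rectangles X J).
have mf : measurable_fun setT ((fun w => \sum_(i in J) a i * X i w) : T' -> R).
  under eq_fun do rewrite big_mkcond.
  apply: measurable_sum => i; case: (boolP (i \in J)) => iJ; last exact: measurable_cst.
  apply: measurable_funM; first exact: measurable_cst.
  move=> _ C mC; rewrite setTI; apply: sub_sigma_algebra.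
  exact: rectangles_preimage.
exact: mf.
Qed.

(** Terms are split off one at a time, each being independent of the group formed by the others.
    Coefficients are nonzero on [J] so that every partial sum has a positive variance, as the rules
    for Gaussian laws above require. *)
Lemma normal_comb_support (R : realType) (d : measure_display)
    (T : measurableType d) (P : probability T R) (I : finType)
    (X : I -> {RV P >-> R}) (v a : I -> R) (J : {set I}) :
  mutually_independent X -> (forall i, 0 < v i) ->
  (forall i, has_normal_law (X i) 0 (v i)) ->
  (forall i, i \in J -> a i != 0) -> (0 < #|J|)%N ->
  forall B, measurable B ->
    P ((fun w => \sum_(i in J) a i * X i w) @^-1` B) =
    normal_prob 0 (Num.sqrt (\sum_(i in J) a i ^+ 2 * v i)) B.
Proof.
move=> indX v0 lawX.
have one i B : a i != 0 -> measurable B ->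
    P ((fun w => a i * X i w) @^-1` B) =
    normal_prob 0 (Num.sqrt (a i ^+ 2 * v i)) B.
  move=> ai0 mB.
  have m1 : measurable ((fun x => a i * x + 0) @^-1` B).
    rewrite -[_ @^-1` _]setTI.
    have mf : measurable_fun [set: R] (fun x : R => a i * x + 0).
      by apply: measurable_funD => //; exact: measurable_funM.
    exact: mf.
  have -> : (fun w => a i * X i w) @^-1` B =
      X i @^-1` ((fun x => a i * x + 0) @^-1` B).
    by apply/seteqP; split=> w /=; rewrite addr0.
  have s0 : Num.sqrt (v i) != 0 by rewrite gt_eqF// sqrtr_gt0.
  transitivity (normal_prob 0 (Num.sqrt (v i)) ((fun x => a i * x + 0) @^-1` B)).
    exact: (lawX i _ m1).
  rewrite (normal_prob_affine 0 0 ai0 s0 mB) mulr0 add0r.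
  apply: normal_prob_sqr; last by rewrite mulf_neq0.
  have vi := ltW (v0 i).
  by rewrite exprMn !sqr_sqrtr// mulr_ge0// sqr_ge0.
move: {2}(#|J|) (leqnn #|J|) => n.
elim: n J => [|n IH] J Jn aJ J0 B mB; first by rewrite leqNgt J0 in Jn.
have [i iJ] : exists i, i \in J by apply/set0Pn; rewrite -card_gt0.
have sumE w : \sum_(j in J) a j * X j w =
    a i * X i w + \sum_(j in J :\ i) a j * X j w by rewrite (big_setD1 i).
under eq_fun do rewrite sumE.
rewrite (big_setD1 i)//=.
have [Ji0|Ji0] := posnP #|J :\ i|.
  have -> : J :\ i = finset.set0 by apply/eqP; rewrite -finset.cards_eq0 Ji0.
  rewrite big_set0 addr0 -one ?aJ//.
  rewrite (_ : (fun w => _ + _) = fun w => a i * X i w)//.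
  by apply/funext => w; rewrite big_set0 addr0.
have mX j : measurable_fun setT (fun w => a j * X j w).
  by apply: measurable_funM => //; exact: measurable_cst.
have sq_gt0 : 0 < \sum_(j in J :\ i) a j ^+ 2 * v j.
  have [k kJ] : exists k, k \in J :\ i by apply/set0Pn; rewrite -card_gt0.
  have ak : a k != 0 by apply: aJ; move: kJ; rewrite inE => /andP[].
  rewrite (big_setD1 k)//= ltr_wpDr//.
    by apply: sumr_ge0 => j _; rewrite mulr_ge0 ?sqr_ge0 ?ltW.
  by rewrite mulr_gt0// exprn_even_gt0.
have ai_gt0 : 0 < a i ^+ 2 * v i by rewrite mulr_gt0// exprn_even_gt0//= aJ.
apply: (normal_sum (s := Num.sqrt (a i ^+ 2 * v i))
  (t := Num.sqrt (\sum_(j in J :\ i) a j ^+ 2 * v j))) => //.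
- rewrite (_ : (fun _ => _) = fun w => \sum_j (if j \in J :\ i then a j * X j w else 0)).
    apply: measurable_sum => j; case: (j \in J :\ i) => //.
  by apply/funext => w; rewrite big_mkcond.
- move=> A C mA mC.
  apply: (mutually_independent_groups indX (J := [set i]%SET) (K := J :\ i)).
  + by move=> j; rewrite !inE => /eqP ->; rewrite eqxx.
  + rewrite (_ : (fun w => _) = fun w => \sum_(j in [set i]%SET) a j * X j w).
      exact: measurable_rectangles_comb.
    by apply/funext => w; rewrite big_set1.
  + exact: measurable_rectangles_comb.
- by rewrite gt_eqF// sqrtr_gt0.
- by rewrite gt_eqF// sqrtr_gt0.
- by rewrite !sqr_sqrtr ?addr_ge0// ltW.
- by move=> C mC; rewrite one// aJ.
- move=> C mC; apply: IH => //.
    by move: Jn; rewrite (cardsD1 i) iJ.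
  by move=> j; rewrite inE => /andP[_ /aJ].
Qed.

Lemma normal_comb (R : realType) (d : measure_display)
    (T : measurableType d) (P : probability T R) (I : finType)
    (X : I -> {RV P >-> R}) (v a : I -> R) (i0 : I) :
  mutually_independent X -> (forall i, 0 < v i) ->
  (forall i, has_normal_law (X i) 0 (v i)) -> a i0 != 0 ->
  forall B, measurable B ->
    P ((fun w => \sum_i a i * X i w) @^-1` B) =
    normal_prob 0 (Num.sqrt (\sum_i a i ^+ 2 * v i)) B.
Proof.
move=> indX v0 lawX ai0 B mB.
pose J := [set i | a i != 0]%SET.
have red (F : I -> R) : \sum_i (if a i != 0 then F i else 0) = \sum_(i in J) F i.
  by rewrite -big_mkcond; apply: eq_bigl => i; rewrite inE.
have -> : (fun w => \sum_i a i * X i w) = fun w => \sum_(i in J) a i * X i w.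
  apply/funext => w; rewrite -red; apply: eq_bigr => i _.
  by case: eqP => //= ->; rewrite mul0r.
have -> : \sum_i a i ^+ 2 * v i = \sum_(i in J) a i ^+ 2 * v i.
  rewrite -red; apply: eq_bigr => i _.
  by case: eqP => //= ->; rewrite expr0n mul0r.
apply: normal_comb_support => //; first by move=> i; rewrite inE.
by apply/card_gt0P; exists i0; rewrite inE.
Qed.

(** * Linear forms in the entries of a Wigner matrix, and Gaussian tails *)

Lemma sum_symmetric (V : nmodType) (p : nat) (f : 'I_p -> 'I_p -> V) :
  (forall i j, f i j = f j i) ->
  \sum_i \sum_j f i j =
  \sum_(ij : {ij : 'I_p * 'I_p | (ij.1 <= ij.2)%N})
    f (val ij).1 (val ij).2 *+ (if (val ij).1 == (val ij).2 then 1 else 2).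
Proof.
move=> fC; rewrite pair_big/= (bigID (fun x : 'I_p * 'I_p => (x.1 <= x.2)%N))/=.
(* The double sum is folded onto the pairs with i <= j, the index type over which the entries are
   independent; off-diagonal terms then count twice. *)
pose g (x : 'I_p * 'I_p) := f x.1 x.2 *+ (if x.1 == x.2 then 1 else 2).
rewrite -/(g) (_ : \sum_(ij : {ij : 'I_p * 'I_p | (ij.1 <= ij.2)%N}) _ =
    \sum_(x : 'I_p * 'I_p | (x.1 <= x.2)%N) g x); last first.
  rewrite [RHS](reindex_omap
      (val : {ij : 'I_p * 'I_p | (ij.1 <= ij.2)%N} -> 'I_p * 'I_p) insub); last first.
    by move=> x Px; rewrite insubT.
  by apply: eq_bigl=> -[x Px]/=; rewrite insubT /= Px eqxx.
pose swap (x : 'I_p * 'I_p) := (x.2, x.1).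
have swap_inj : injective swap by move=> [x y] [x' y'] [-> ->].
have -> : \sum_(x : 'I_p * 'I_p | ~~ (x.1 <= x.2)%N) f x.1 x.2 =
    \sum_(x : 'I_p * 'I_p | (x.1 < x.2)%N) f x.1 x.2.
  rewrite (reindex_inj swap_inj)/=; apply: eq_big => [x|x _]; last exact: fC.
  by rewrite -ltnNge.
have -> : \sum_(x : 'I_p * 'I_p | (x.1 < x.2)%N) f x.1 x.2 =
    \sum_(x : 'I_p * 'I_p | (x.1 <= x.2)%N) (if x.1 == x.2 then 0 else f x.1 x.2).
  rewrite big_mkcond [RHS]big_mkcond; apply: eq_bigr => x _ /=.
  rewrite ltn_neqAle -(inj_eq val_inj).
  by case: (x.1 <= x.2)%N; rewrite ?andbF// andbT; case: eqP.
rewrite -big_split; apply: eq_bigr => x _; rewrite /g.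
by case: eqP => _ /=; rewrite ?addr0.
Qed.

(** After folding, a diagonal term contributes 2 a^2 to the variance and an off-diagonal one (2 a)^2
    = 2 (a^2 + a^2). The diagonal variance 2 is exactly what makes the total proportional to the sum
    of all squares. *)
Lemma wigner_quadratic_law (R : realType) (d : measure_display)
    (T : measurableType d) (P : probability T R) (p : nat)
    (W : 'I_p -> 'I_p -> {RV P >-> R}) (a : 'I_p -> 'I_p -> R) :
  gaussian_wigner W -> (forall i j, a i j = a j i) ->
  0 < \sum_i \sum_j a i j ^+ 2 ->
  forall B, measurable B ->
    P ((fun w => \sum_i \sum_j a i j * W i j w) @^-1` B) =
    normal_prob 0 (Num.sqrt (2 * \sum_i \sum_j a i j ^+ 2)) B.
Proof.
move=> [WC indW diagW offW] aC a_gt0 B mB.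
pose I := {ij : 'I_p * 'I_p | (ij.1 <= ij.2)%N}.
pose k (x : I) : nat := if (val x).1 == (val x).2 then 1 else 2.
pose c (x : I) : R := a (val x).1 (val x).2 *+ k x.
pose v (x : I) : R := if (val x).1 == (val x).2 then 2 else 1.
pose X (x : I) := W (val x).1 (val x).2.
have -> : (fun w => \sum_i \sum_j a i j * W i j w) = fun w => \sum_x c x * X x w.
  apply/funext => w; rewrite sum_symmetric; last by move=> i j; rewrite aC WC.
  by apply: eq_bigr => x _; rewrite mulrnAl.
have sqE : 2 * \sum_i \sum_j a i j ^+ 2 = \sum_x c x ^+ 2 * v x.
  rewrite sum_symmetric; last by move=> i j; rewrite aC.
  rewrite mulr_sumr; apply: eq_bigr => x _; rewrite /c /v /k.
  case: eqP => _; rewrite ?mulr1n; first by rewrite mulrC.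
  ring.
have v0 x : 0 < v x by rewrite /v; case: ifP.
have [x cx] : exists x, c x != 0.
  apply/existsP; rewrite -negb_forall; apply/negP => /forallP c0.
  have : 2 * \sum_i \sum_j a i j ^+ 2 = 0.
    by rewrite sqE big1// => x _; rewrite (eqP (c0 x)) expr0n mul0r.
  by apply/eqP; rewrite mulf_neq0// gt_eqF.
rewrite sqE; apply: (normal_comb (i0 := x)) => //.
move=> [[i j] /= ij]; rewrite /X /v /=.
case: eqP => [->|/eqP ne]; first exact: diagW.
by apply: offW; rewrite ltn_neqAle ij andbT.
Qed.

Lemma measurable_expR_scale (R : realType) (d : measure_display)
    (T : measurableType d) (X : T -> R) (c : R) :
  measurable_fun setT X -> measurable_fun setT (fun w => (expR (c * X w))%:E).
Proof.
move=> mX; apply/measurable_EFinP.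
apply: (@measurableT_comp _ _ _ _ _ _ (@expR R) _ (fun w => c * X w)) => //.
by apply: measurable_funM => //; exact: measurable_cst.
Qed.

Lemma normal_mgf (R : realType) (d : measure_display) (T : measurableType d)
    (P : probability T R) (X : T -> R) (s c : R) :
  measurable_fun setT X -> s != 0 ->
  (forall B, measurable B -> P (X @^-1` B) = normal_prob 0 s B) ->
  (\int[P]_w (expR (c * X w))%:E = (expR (c ^+ 2 * s ^+ 2 / 2))%:E)%E.
Proof.
move=> mX s0 PX.
have mE : measurable_fun [set: R] (fun x : R => (expR (c * x))%:E).
  exact: measurable_expR_scale.
pose mX_mixin := isMeasurableFun.Build _ _ _ _ _
  (mX : measurable_fun setT (X : T -> measurableTypeR R)).
pose X' : {mfun T >-> measurableTypeR R} := HB.pack (X : T -> measurableTypeR R) mX_mixin.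
transitivity (\int[distribution P X']_x (expR (c * x))%:E)%E.
  rewrite ge0_integral_distribution//.
rewrite (eq_measure_integral (normal_prob 0 s)); last by move=> A mA _; exact: PX.
have E0 x : (0 <= (expR (c * x))%:E :> \bar R)%E by rewrite lee_fin expR_ge0.
rewrite (integral_normal_prob 0 s mE E0).
(* Exponential tilting: multiplying the centred density by e^(c x) shifts its mean to c s^2, up to a
   constant factor. *)
have E x : ((expR (c * x))%:E * (normal_pdf 0 s x)%:E =
    (expR (c ^+ 2 * s ^+ 2 / 2))%:E * (normal_pdf (c * s ^+ 2) s x)%:E)%E.
  rewrite -!EFinM; congr EFin; rewrite !normal_pdfE// mulrCA [RHS]mulrCA.
  congr (_ * _); rewrite /normal_fun -!expRD; congr expR; field.
  exact: s0.
under eq_integral do rewrite E.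
have mpdf m v : measurable_fun setT (fun z : R => (normal_pdf m v z)%:E).
  by apply/measurable_EFinP; exact: measurable_normal_pdf.
have pdf0 m v (z : R) : (0 <= (normal_pdf m v z)%:E)%E by rewrite lee_fin normal_pdf_ge0.
rewrite ge0_integralZl//; last exact: mpdf.
by rewrite integral_normal_pdf mule1.
Qed.

Lemma markov_expR (R : realType) (d : measure_display) (T : measurableType d)
    (P : probability T R) (X : T -> R) (c t : R) : measurable_fun setT X -> 0 <= c ->
  (P [set w | (t <= X w)%R] <= (expR (- (c * t)))%:E * \int[P]_w (expR (c * X w))%:E)%E.
Proof.
move=> mX c0.
have mA : measurable [set w | t <= X w].
  rewrite -[X in measurable X]setTI (_ : [set w | _] = X @^-1` `[t, +oo[%classic).
    by apply: mX => //; exact: measurable_itv.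
  by apply/seteqP; split=> w /=; rewrite in_itv/= andbT.
have mE : measurable_fun setT (fun w => (expR (c * X w))%:E).
  exact: measurable_expR_scale.
have E0 w : (0 <= (expR (c * X w))%:E :> \bar R)%E by rewrite lee_fin expR_ge0.
have k0 : (0 <= (expR (- (c * t)))%:E :> \bar R)%E by rewrite lee_fin expR_ge0.
rewrite -ge0_integralZl//.
rewrite -[X in (P X)]setIT -integral_indic//; apply: ge0_le_integral => //.
- exact/measurable_EFinP/measurable_indic.
- by apply: emeasurable_funM => //; exact: measurable_cst.
- move=> w _; rewrite -EFinM lee_fin -expRD indicE.
  case: (boolP (w \in _)) => [|_]; last exact: expR_ge0.
  rewrite inE /= => tX; rewrite -[leLHS]expR0 ler_expR addrC subr_ge0.
  exact: ler_wpM2l.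
Qed.

Lemma normal_tail_le (R : realType) (d : measure_display) (T : measurableType d)
    (P : probability T R) (X : T -> R) (s t : R) :
  measurable_fun setT X -> s != 0 -> 0 <= t ->
  (forall B, measurable B -> P (X @^-1` B) = normal_prob 0 s B) ->
  (P [set w | (t <= X w)%R] <= (expR (- (t ^+ 2 / (s ^+ 2 *+ 2))))%:E)%E.
Proof.
move=> mX s0 t0 PX.
(* This is the slope that minimizes the Chernoff exponent c^2 s^2 / 2 - c t. *)
have c0 : 0 <= t / s ^+ 2 by rewrite divr_ge0// sqr_ge0.
apply: (le_trans (markov_expR _ _ mX c0)).
rewrite (normal_mgf _ mX s0 PX) -EFinM -expRD lee_fin ler_expR le_eqVlt.
apply/orP; left; apply/eqP; field; exact: s0.
Qed.

(** Only the window from [t] to [t + e] is kept, where the density is at least its value at the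
    right end. The width [e] is chosen later, so that its cost in the exponent is a small fraction
    of the gain. *)
Lemma normal_tail_ge (R : realType) (s t e : R) : 0 < s -> 0 <= t -> 0 < e ->
  ((e * normal_peak s * expR (- ((t + e) ^+ 2 / (s ^+ 2 *+ 2))))%:E <=
   normal_prob 0 s `[t, +oo[%classic)%E.
Proof.
move=> s_gt0 t0 e0; have s0 : s != 0 by rewrite gt_eqF.
have mI : measurable `[t, t + e]%classic by exact: measurable_itv.
apply: (@le_trans _ _ (normal_prob 0 s `[t, t + e]%classic)); last first.
  apply: le_measure; rewrite ?inE//=.
  by move=> x /=; rewrite !in_itv/= => /andP[->].
pose k := normal_peak s * expR (- ((t + e) ^+ 2 / (s ^+ 2 *+ 2))).
apply: (@le_trans _ _ (\int[lebesgue_measure]_(x in `[t, (t + e)%R]) k%:E)%E).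
  rewrite integral_cst//= lebesgue_measure_itv/= lte_fin ltrDl e0 -EFinB -EFinM.
  rewrite lee_fin (_ : t + e - t = e) ?[k * e]mulrC ?mulrA//; ring.
apply: ge0_le_integral => //.
- by move=> x _; rewrite lee_fin mulr_ge0 ?normal_peak_ge0 ?expR_ge0.
- by apply/measurable_EFinP; apply: measurable_funTS; exact: measurable_normal_pdf.
- move=> x /=; rewrite in_itv/= => /andP[tx xte].
  rewrite lee_fin normal_pdfE// ler_wpM2l ?normal_peak_ge0// /normal_fun ler_expR.
  rewrite subr0 mulNr lerN2 ler_wpM2r ?invr_ge0 ?mulrn_wge0 ?sqr_ge0//.
  by rewrite ler_sqr ?nnegrE// ?(le_trans t0)// ler_wpDr// ltW.
Qed.

(** * Rayleigh quotients *)

Definition bilin (R : realType) (k : nat) (A : 'M[R]_k) (u e : 'I_k -> R) : R :=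
  \sum_i \sum_j u i * e j * A i j.

Definition qform (R : realType) (k : nat) (A : 'M[R]_k) (u : 'I_k -> R) : R :=
  bilin A u u.

Definition dotp (R : realType) (k : nat) (u e : 'I_k -> R) : R :=
  \sum_i u i * e i.

Lemma continuous_finite_sum (R : realType) (T : topologicalType) (I : Type)
    (s : seq I) (f : I -> T -> R) :
  (forall i, continuous (f i)) -> continuous (fun x => \sum_(i <- s) f i x).
Proof.
move=> cf; elim: s => [|i s IH].
  under eq_fun do rewrite big_nil; exact: cst_continuous.
under eq_fun do rewrite big_cons.
by move=> x; apply: (@continuousD _ R^o); [exact: cf|exact: IH].
Qed.

Lemma dotp_ge0 (R : realType) (k : nat) (u : 'I_k -> R) : 0 <= dotp u u.
Proof. by apply: sumr_ge0 => i _; rewrite -expr2 sqr_ge0. Qed.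

Lemma dotp_eq0 (R : realType) (k : nat) (u : 'I_k -> R) :
  dotp u u = 0 -> forall i, u i = 0.
Proof.
move=> /eqP; rewrite psumr_eq0; last by move=> i _; rewrite -expr2 sqr_ge0.
move=> /allP H i; have := H i; rewrite mem_index_enum => /(_ isT).
by rewrite mulf_eq0 orbb => /eqP.
Qed.

Lemma bilinZ (R : realType) (k : nat) (A : 'M[R]_k) (a b : R) (u e : 'I_k -> R) :
  bilin A (fun i => a * u i) (fun i => b * e i) = a * b * bilin A u e.
Proof.
rewrite /bilin mulr_sumr; apply: eq_bigr => i _; rewrite mulr_sumr.
by apply: eq_bigr => j _; ring.
Qed.

Lemma dotpZ (R : realType) (k : nat) (a b : R) (u e : 'I_k -> R) :
  dotp (fun i => a * u i) (fun i => b * e i) = a * b * dotp u e.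
Proof. by rewrite /dotp mulr_sumr; apply: eq_bigr => i _; ring. Qed.

Lemma bilinC (R : realType) (k : nat) (A : 'M[R]_k) (u e : 'I_k -> R) :
  A^T = A -> bilin A u e = bilin A e u.
Proof.
move=> AT; rewrite /bilin exchange_big; apply: eq_bigr => i _.
by apply: eq_bigr => j _; rewrite -{1}AT mxE (mulrC (u _)).
Qed.

Lemma bilinDr (R : realType) (k : nat) (A : 'M[R]_k) (u e f : 'I_k -> R) :
  bilin A u (fun i => e i + f i) = bilin A u e + bilin A u f.
Proof.
rewrite /bilin -big_split; apply: eq_bigr => i _; rewrite -big_split.
by apply: eq_bigr => j _ /=; ring.
Qed.

Lemma qformD (R : realType) (k : nat) (A : 'M[R]_k) (u e : 'I_k -> R) :
  A^T = A ->
  qform A (fun i => u i + e i) = qform A u + 2 * bilin A u e + qform A e.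
Proof.
move=> AT; pose ue i := u i + e i.
rewrite /qform bilinDr (bilinC ue u AT) (bilinC ue e AT) !bilinDr.
by rewrite (bilinC e u AT); ring.
Qed.

Lemma dotpD (R : realType) (k : nat) (u e : 'I_k -> R) :
  dotp (fun i => u i + e i) (fun i => u i + e i) =
  dotp u u + 2 * dotp u e + dotp e e.
Proof.
rewrite /dotp mulr_sumr -!big_split; apply: eq_bigr => i _ /=; ring.
Qed.

Lemma nonneg_quadratic_linear0 (R : realType) (b c : R) :
  (forall t, 0 <= 2 * t * b + t ^+ 2 * c) -> b = 0.
Proof.
move=> H; apply/eqP; apply/negPn/negP => b0.
pose d := `|c| + 1.
have d0 : 0 < d by rewrite ltr_wpDl.
have cd : c <= d by rewrite (le_trans (ler_norm c))// lerDl.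
(* The minimizer is - b / c; replacing [c] by the positive upper bound [d] avoids a discussion of
   its sign and still makes the value negative. *)
have := H (- (b / d)).
have -> : 2 * - (b / d) * b + (- (b / d)) ^+ 2 * c =
    b ^+ 2 / d ^+ 2 * (c - 2 * d) by field; rewrite gt_eqF.
have p : 0 < b ^+ 2 / d ^+ 2 by rewrite divr_gt0// exprn_even_gt0//= ?b0// gt_eqF.
by rewrite pmulr_rge0// => ?; lra.
Qed.

Lemma rayleigh_maximum (R : realType) (k : nat) (A : 'M[R]_k) : (0 < k)%N ->
  exists v : 'I_k -> R, dotp v v = 1 /\
    forall u, qform A u <= qform A v * dotp u u.
Proof.
case: k A => // k A _.
pose N (v : 'rV[R]_k.+1) := dotp (v 0) (v 0).
pose f (v : 'rV[R]_k.+1) := qform A (v 0).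
have cc (i : 'I_k.+1) : continuous (fun v : 'rV[R]_k.+1 => v 0 i).
  exact: coord_continuous.
have cN : continuous N.
  apply: continuous_finite_sum => i v.
  by apply: continuousM; exact: cc.
have cf : continuous f.
  apply: continuous_finite_sum => i; apply: continuous_finite_sum => j v.
  apply: (@continuousM _ _ (fun v : 'rV[R]_k.+1 => v 0 i * v 0 j) (fun=> A i j)).
    by apply: continuousM; exact: cc.
  exact: cst_continuous.
pose K := N @^-1` [set 1].
have clK : closed K.
  apply: preimage_closed; last exact: closed_eq.
  by move=> v _; exact: cN.
have bK : bounded_set K.
  exists 1; split => // M M1 v Kv; apply: le_trans (ltW M1).
  rewrite /Num.norm/= mx_normrE; apply: bigmax_le => // -[i j] _ /=.
  rewrite ord1 -(@ler_pXn2r _ 2)// ?nnegrE// expr1n real_normK ?num_real//.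
  rewrite -Kv /N /dotp (bigD1 j)//= expr2 lerDl.
  by apply: sumr_ge0 => l _; rewrite -expr2 sqr_ge0.
have K0 : K !=set0.
  exists (delta_mx 0 ord0); rewrite /K /N /dotp /= (bigD1 ord0)//= !mxE eqxx mulr1.
  by rewrite big1 ?addr0// => i i0; rewrite mxE eqxx/= (negbTE i0) mul0r.
have [c cK cmax] := EVT_max_rV K0 (bounded_closed_compact bK clK)
  (continuous_subspaceT cf).
exists (c 0); split; first by move: cK; rewrite inE.
move=> u; have [u0|u0] := eqVneq (dotp u u) 0.
  rewrite u0 mulr0 /qform /bilin big1// => i _; rewrite big1// => j _.
  by rewrite (dotp_eq0 u0 i) !mul0r.
have u_gt0 : 0 < dotp u u by rewrite lt_def u0 dotp_ge0.
pose s := (Num.sqrt (dotp u u))^-1.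
have s2 : s * s = (dotp u u)^-1.
  by rewrite -expr2 exprVn sqr_sqrtr// ltW.
pose u' : 'rV[R]_k.+1 := \row_i (s * u i).
have u'E : u' 0 = (fun i => s * u i) by apply/funext => i; rewrite mxE.
have u'K : u' \in K by rewrite inE /K /N /= u'E dotpZ s2 mulVf.
have := cmax u' u'K; rewrite /f u'E /qform bilinZ s2 mulrC.
by rewrite ler_pdivrMr.
Qed.

(** First-order condition: along [v + t e] the nonnegative difference of the two sides of the
    maximality inequality is a quadratic polynomial in [t] vanishing at 0, so its linear coefficient
    is zero. *)
Lemma rayleigh_stationary (R : realType) (k : nat) (A : 'M[R]_k) (v : 'I_k -> R) :
  A^T = A -> dotp v v = 1 -> (forall u, qform A u <= qform A v * dotp u u) ->
  forall e, bilin A v e = qform A v * dotp v e.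
Proof.
move=> AT v1 vmax e.
apply/eqP; rewrite eq_sym -subr_eq0; apply/eqP.
apply: (@nonneg_quadratic_linear0 _ _ (qform A v * dotp e e - qform A e)) => t.
have := vmax (fun i => v i + t * e i).
rewrite qformD// dotpD /qform bilinZ.
have -> : bilin A v (fun i => t * e i) = t * bilin A v e.
  rewrite -[t in RHS]mul1r -bilinZ; congr bilin.
  by apply/funext => i; rewrite mul1r.
have -> : dotp v (fun i => t * e i) = t * dotp v e.
  rewrite -[t in RHS]mul1r -dotpZ; congr dotp.
  by apply/funext => i; rewrite mul1r.
rewrite dotpZ v1 -/(qform A v) -/(qform A e) => H.
rewrite -subr_ge0 in H; move: H; congr (0 <= _); ring.
Qed.

Lemma bilin_mulmx (R : realType) (k : nat) (A : 'M[R]_k) (u : 'rV[R]_k)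
    (e : 'I_k -> R) :
  bilin A (u 0) e = \sum_j (u *m A) 0 j * e j.
Proof.
rewrite /bilin exchange_big; apply: eq_bigr => j _; rewrite mxE mulr_suml.
by apply: eq_bigr => i _; ring.
Qed.

(** The bridge from the supremum of the spectrum to the variational characterization. The
    eigenvector equation is kept in the form tested against every [e], because rounding needs the
    exact value of the cross term. *)
Lemma lambda_max_rayleigh (R : realType) (k : nat) (A : 'M[R]_k) :
  A^T = A -> (0 < k)%N ->
  exists v : 'I_k -> R, [/\ dotp v v = 1,
    forall u, qform A u <= lambda_max A * dotp u u &
    forall e, bilin A v e = lambda_max A * dotp v e].
Proof.
move=> AT k0; have [v [v1 vmax]] := rayleigh_maximum A k0.
have stat := rayleigh_stationary AT v1 vmax.
suff -> : lambda_max A = qform A v by exists v.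
pose E := [set a : R | eigenvalue A a].
have Ev : E (qform A v).
  apply/eigenvalueP; exists (\row_i v i); last first.
    apply/negP => /eqP v0; have := @oner_neq0 R; rewrite -v1 /dotp big1 ?eqxx//.
    by move=> i _; move/rowP: v0 => /(_ i); rewrite !mxE => ->; rewrite mul0r.
  have uv : (\row_i v i : 'rV[R]_k) 0 = v by apply/funext => i; rewrite mxE.
  apply/rowP => j; have := stat (fun i => (i == j)%:R).
  rewrite -[X in bilin A X _ = _]uv bilin_mulmx (bigD1 j)//= eqxx mulr1 big1 ?addr0;
    last by move=> i /negbTE ->; rewrite mulr0.
  move=> H; rewrite [LHS]H [RHS]mxE mxE; congr (_ * _).
  rewrite /dotp (bigD1 j)//= eqxx mulr1 big1 ?addr0//.
  by move=> i /negbTE ->; rewrite mulr0.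
have uE : ubound E (qform A v).
  move=> a /eigenvalueP[u uA u0].
  have q : qform A (u 0) = a * dotp (u 0) (u 0).
    rewrite /qform bilin_mulmx uA /dotp mulr_sumr.
    by apply: eq_bigr => i _; rewrite mxE mulrA.
  have := vmax (u 0); rewrite q ler_pM2r// lt_def dotp_ge0 andbT.
  apply: contra u0 => /eqP/dotp_eq0 H; apply/eqP/rowP => i.
  by rewrite H mxE.
apply/eqP; rewrite eq_le; apply/andP; split.
  by apply: ge_sup => //; exists (qform A v).
apply: sup_upper_bound => //; split; first by exists (qform A v).
by exists (qform A v).
Qed.

(** Vectors of a principal submatrix are represented by vectors of the full space vanishing off [S]:
    all sets then share one matrix and one dimension, and the type indexed by [#|S|] disappears. *)
Definition supported (R : realType) (p : nat) (S : {set 'I_p}) (u : 'I_p -> R) :=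
  forall i, i \notin S -> u i = 0.

Definition extend0 (R : realType) (p : nat) (S : {set 'I_p}) (v : 'I_#|S| -> R)
    (i : 'I_p) : R :=
  \sum_k v k *+ (enum_val k == i).

Lemma extend0_enum_val (R : realType) (p : nat) (S : {set 'I_p})
    (v : 'I_#|S| -> R) k : extend0 v (enum_val k) = v k.
Proof.
rewrite /extend0 (bigD1 k)//= eqxx big1 ?addr0// => l lk.
by rewrite (inj_eq enum_val_inj) (negbTE lk).
Qed.

Lemma extend0_supported (R : realType) (p : nat) (S : {set 'I_p})
    (v : 'I_#|S| -> R) : supported S (extend0 v).
Proof.
move=> i iS; rewrite /extend0 big1// => k _.
by case: eqP => // ki; move: iS; rewrite -ki enum_valP.
Qed.

Lemma sum_supported (R : realType) (p : nat) (S : {set 'I_p}) (F : 'I_p -> R) :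
  (forall i, i \notin S -> F i = 0) -> \sum_i F i = \sum_(k < #|S|) F (enum_val k).
Proof.
move=> F0; rewrite -(big_enum_val (A := mem S)) [RHS]big_mkcond; apply: eq_bigr => i _ /=.
by case: ifPn => // /F0.
Qed.

Lemma bilin_submx (R : realType) (p : nat) (A : 'M[R]_p) (S : {set 'I_p})
    (u e : 'I_p -> R) : supported S u -> supported S e ->
  bilin A u e = bilin (principal_submx A S) (u \o enum_val) (e \o enum_val).
Proof.
move=> uS eS; rewrite /bilin (@sum_supported _ _ S); last first.
  by move=> i iS; rewrite big1// => j _; rewrite uS// !mul0r.
apply: eq_bigr => i _; rewrite (@sum_supported _ _ S); last first.
  by move=> j jS; rewrite (eS j)// mulr0 mul0r.
by apply: eq_bigr => j _; rewrite mxE.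
Qed.

Lemma dotp_submx (R : realType) (p : nat) (S : {set 'I_p}) (u e : 'I_p -> R) :
  supported S u -> dotp u e = dotp (u \o enum_val : 'I_#|S| -> R) (e \o enum_val).
Proof.
move=> uS; rewrite /dotp (@sum_supported _ _ S)//.
by move=> i iS; rewrite uS// mul0r.
Qed.

Lemma principal_submx_sym (R : realType) (p : nat) (A : 'M[R]_p) (S : {set 'I_p}) :
  A^T = A -> (principal_submx A S)^T = principal_submx A S.
Proof. by move=> AT; apply/matrixP => i j; rewrite !mxE -{1}AT mxE. Qed.

Lemma max_lambda_argmax (R : realType) (m p : nat) (A : 'M[R]_p) :
  (m <= p)%N ->
  exists S : {set 'I_p}, [/\ #|S| = m,
    max_lambda m A = lambda_max (principal_submx A S) &
    forall S' : {set 'I_p}, #|S'| = m ->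
      lambda_max (principal_submx A S') <= lambda_max (principal_submx A S)].
Proof.
move=> mp.
have [S0 S0m] : exists S : {set 'I_p}, #|S| == m.
  have : (0 < #|[set S : {set 'I_p} | #|S| == m]%SET|)%N.
    by rewrite card_draws card_ord bin_gt0.
  by move=> /card_gt0P[S]; rewrite inE => Sm; exists S.
pose F (S : {set 'I_p}) := lambda_max (principal_submx A S).
have [S /eqP Sm Smax] := @arg_maxP _ _ _ S0 (fun S : {set 'I_p} => #|S| == m) F S0m.
have H (S' : {set 'I_p}) : #|S'| = m -> F S' <= F S.
  by move=> S'm; apply: Smax; rewrite S'm.
exists S; split => //.
apply/eqP; rewrite eq_le; apply/andP; split.
  apply: ge_sup; first by exists (F S), S.
  by move=> _ [S' /= /H FS' <-].
apply: sup_upper_bound; last by exists S.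
split; first by exists (F S), S.
by exists (F S) => _ [S' /= /H FS' <-].
Qed.

(* Failing conversion tests between two values of [max_lambda] unfold the suprema
   and do not terminate in practice, hence this opaque copy. *)
Fact top_lambda_def : {f : forall (R : realType) (m p : nat), 'M[R]_p -> R |
  forall (R : realType) (m p : nat) (A : 'M[R]_p), f R m p A = max_lambda m A}.
Proof. by exists max_lambda. Qed.

Definition top_lambda (R : realType) (m p : nat) (A : 'M[R]_p) : R :=
  sval top_lambda_def R m p A.

Lemma top_lambdaE (R : realType) (m p : nat) (A : 'M[R]_p) :
  top_lambda m A = max_lambda m A.
Proof. exact: (svalP top_lambda_def). Qed.

Lemma qform_le_top_lambda (R : realType) (m p : nat) (A : 'M[R]_p)
    (S : {set 'I_p}) (u : 'I_p -> R) :
  A^T = A -> (0 < m <= p)%N -> #|S| = m -> supported S u ->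
  qform A u <= top_lambda m A * dotp u u.
Proof.
move=> AT /andP[m0 mp] Sm uS.
rewrite top_lambdaE; have [S' [S'm -> S'max]] := max_lambda_argmax A mp.
have S0 : (0 < #|S|)%N by rewrite Sm.
have [v [v1 vmax _]] := lambda_max_rayleigh (principal_submx_sym S AT) S0.
rewrite /qform (bilin_submx _ uS uS) (dotp_submx _ uS).
apply: (le_trans (vmax _)); rewrite ler_wpM2r ?dotp_ge0//.
by apply: S'max.
Qed.

Lemma top_lambda_attained (R : realType) (m p : nat) (A : 'M[R]_p) :
  A^T = A -> (0 < m <= p)%N ->
  exists (S : {set 'I_p}) (u : 'I_p -> R), [/\ #|S| = m, supported S u,
    dotp u u = 1 &
    forall e, supported S e -> bilin A u e = top_lambda m A * dotp u e].
Proof.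
move=> AT /andP[m0 mp].
rewrite top_lambdaE; have [S [Sm -> _]] := max_lambda_argmax A mp.
have S0 : (0 < #|S|)%N by rewrite Sm.
have [v [v1 _ vst]] := lambda_max_rayleigh (principal_submx_sym S AT) S0.
have uS : supported S (extend0 v) by exact: extend0_supported.
have uE : (extend0 v : 'I_p -> R) \o enum_val = v.
  by apply/funext => k /=; rewrite extend0_enum_val.
exists S, (extend0 v); split => //; first by rewrite (dotp_submx _ uS) uE.
by move=> e eS; rewrite (bilin_submx _ uS eS) (dotp_submx _ uS) uE vst.
Qed.

(** Sublevel sets of the maximum become families of inequalities that are linear in the entries of
    [A], which is what measurability is derived from. *)
Lemma top_lambda_leP (R : realType) (m p : nat) (A : 'M[R]_p) (c : R) :
  A^T = A -> (0 < m <= p)%N ->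
  top_lambda m A <= c <->
  forall (S : {set 'I_p}) u, #|S| = m -> supported S u -> qform A u <= c * dotp u u.
Proof.
move=> AT mp; split=> [Ac S u Sm uS|H].
  apply: (le_trans (qform_le_top_lambda AT mp Sm uS)).
  by rewrite ler_wpM2r ?dotp_ge0.
have [S [u [Sm uS u1 ust]]] := top_lambda_attained AT mp.
by have := H S u Sm uS; rewrite /qform ust// u1 !mulr1.
Qed.

Lemma eigenvalue_opp (R : realType) (k : nat) (A : 'M[R]_k) (a : R) :
  eigenvalue (- A) a = eigenvalue A (- a).
Proof.
apply/eigenvalueP/eigenvalueP => -[v vA v0]; exists v => //.
  by rewrite scaleNr -vA mulmxN opprK.
by rewrite mulmxN vA scaleNr opprK.
Qed.

Lemma lambda_min_opp (R : realType) (k : nat) (A : 'M[R]_k) :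
  lambda_min A = - lambda_max (- A).
Proof.
rewrite /lambda_min /lambda_max /inf; congr (- sup _).
apply/seteqP; split=> a /=; first by move=> [b Ab <-]; rewrite eigenvalue_opp opprK.
by rewrite eigenvalue_opp => Aa; exists (- a) => //; rewrite opprK.
Qed.

Lemma min_lambda_opp (R : realType) (m p : nat) (A : 'M[R]_p) :
  min_lambda m A = - top_lambda m (- A).
Proof.
rewrite top_lambdaE /min_lambda /max_lambda /inf; congr (- sup _).
have E S : lambda_max (principal_submx (- A) S) = - lambda_min (principal_submx A S).
  rewrite lambda_min_opp opprK; congr lambda_max.
  by apply/matrixP => i j; rewrite !mxE.
apply/seteqP; split=> a /=.
  by move=> [_ [S Sm <-] <-]; exists S.
by move=> [S Sm <-]; exists (lambda_min (principal_submx A S)) => //; exists S.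
Qed.

(** * Rounding eigenvectors to a finite grid *)

(* The index [K] encodes the coordinate [0]; the mesh is [1 / K]. *)
Definition grid_vector (R : realType) (p K : nat)
    (g : {ffun 'I_p -> 'I_(K.*2.+1)}) (i : 'I_p) : R :=
  (g i)%:R / K%:R - 1.

(** Cauchy-Schwarz against a unit vector, obtained by expanding the squared norm of [r u + s e] for
    the two signs s = 1 and s = -1. *)
Lemma dotp_le (R : realType) (p : nat) (u e : 'I_p -> R) (r : R) : 0 < r ->
  dotp u u = 1 -> dotp e e <= r ^+ 2 -> `|dotp u e| <= r.
Proof.
move=> r0 u1 er.
have key (s : R) : s ^+ 2 = 1 -> - (s * dotp u e) <= r.
  move=> s1; have := dotp_ge0 (fun i => r * u i + s * e i).
  rewrite dotpD !dotpZ u1 => H.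
  have : 0 <= 2 * r * (r + s * dotp u e).
    apply: (le_trans H); have -> : s * s = 1 by rewrite -expr2.
    by move: er; rewrite expr2 => er; lra.
  by rewrite pmulr_rge0 ?mulr_gt0//; lra.
rewrite ler_norml; apply/andP; split.
  by have := key 1 (expr1n _ _); lra.
by have := key (-1); rewrite sqrrN expr1n => /(_ erefl); lra.
Qed.

Lemma norm_le1_addr1 (R : realType) (x : R) : `|x| <= 1 -> 0 <= x + 1 <= 2.
Proof. by rewrite ler_norml => /andP[? ?]; apply/andP; split; lra. Qed.

Lemma floor_error (R : realType) (x y : R) : x <= y < x + 1 -> 0 <= y - x <= 1.
Proof. by move=> /andP[? ?]; apply/andP; split; lra. Qed.

Lemma ge0_of_opp_le (R : realType) (x y : R) : - y <= x -> y <= x -> 0 <= x.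
Proof. lra. Qed.

Lemma perturbed_sqnorm (R : realType) (x y r : R) :
  `|x| <= r -> y <= r ^+ 2 -> 1 + 2 * x + y <= (1 + r) ^+ 2.
Proof. by move=> xr yr; have := ler_norm x; lra. Qed.

Lemma perturbed_qform (R : realType) (L x r q : R) :
  0 <= L -> `|x| <= r -> - q <= L * r ^+ 2 ->
  L * (1 - 2 * r - r ^+ 2) <= L + 2 * (L * x) + q.
Proof.
move=> L0 xr Lq.
have : - (L * r) <= L * x.
  by rewrite -mulrN ler_wpM2l//; move: xr; rewrite ler_norml => /andP[].
lra.
Qed.

Lemma qform_opp (R : realType) (k : nat) (A : 'M[R]_k) (u : 'I_k -> R) :
  qform (- A) u = - qform A u.
Proof.
rewrite /qform /bilin -sumrN; apply: eq_bigr => i _; rewrite -sumrN.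
by apply: eq_bigr => j _; rewrite mxE mulrN.
Qed.

(** At a top eigenvector of [A] the form of [B] takes the opposite value. The larger of the two top
    eigenvalues is therefore nonnegative. The relation between [A] and [B] is expressed through
    their forms so that their roles can be exchanged. *)
Lemma top_lambda_opp_ge (R : realType) (m p : nat) (A B : 'M[R]_p) :
  A^T = A -> B^T = B -> (forall u, qform B u = - qform A u) ->
  (0 < m <= p)%N -> - top_lambda m B <= top_lambda m A.
Proof.
move=> AT BT BA mp; have [S [v [Sm vS v1 vst]]] := top_lambda_attained AT mp.
have := qform_le_top_lambda BT mp Sm vS.
by rewrite BA /qform (vst v vS) v1 !mulr1 lerNl.
Qed.

(* Rounding a top unit eigenvector [v] of [A] to the grid: the cross term is
   exactly [top * dotp v e], and the rounding error [e] contributes at least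
   [- top * dotp e e] because the quadratic form of [B = - A] is bounded by
   [top_lambda m B <= top_lambda m A]. *)
Lemma grid_approx (R : realType) (m p K : nat) (A B : 'M[R]_p) (r : R) :
  A^T = A -> B^T = B -> (forall u, qform B u = - qform A u) ->
  (0 < m <= p)%N -> (0 < K)%N -> 0 < r ->
  m%:R <= (r * K%:R) ^+ 2 -> top_lambda m B <= top_lambda m A ->
  exists (S : {set 'I_p}) (g : {ffun 'I_p -> 'I_(K.*2.+1)}),
    [/\ #|S| = m, forall i, i \notin S -> g i = inord K,
      dotp (grid_vector R g) (grid_vector R g) <= (1 + r) ^+ 2 &
      top_lambda m A * (1 - 2 * r - r ^+ 2) <= qform A (grid_vector R g)].
Proof.
move=> AT BT BA mp K0 r0 mK AA.
have [S [v [Sm vS v1 vst]]] := top_lambda_attained AT mp.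
have KR : 0 < K%:R :> R by rewrite ltr0n.
have v_le i : `|v i| <= 1.
  rewrite -(@ler_pXn2r _ 2)// ?nnegrE// expr1n real_normK ?num_real//.
  rewrite -v1 /dotp (bigD1 i)//= expr2 lerDl.
  by apply: sumr_ge0 => j _; rewrite -expr2 sqr_ge0.
pose n i : nat := Num.truncn (K%:R * (v i + 1)).
have nP i : (n i)%:R <= K%:R * (v i + 1) < (n i)%:R + 1.
  have := @truncn_itv R (K%:R * (v i + 1)); rewrite -natr1; apply.
  apply: mulr_ge0; first exact: ltW.
  by have /norm_le1_addr1/andP[] := v_le i.
have n_le i : (n i <= K.*2)%N.
  rewrite -(@ler_nat R); have /andP[ni _] := nP i; apply: (le_trans ni).
  rewrite -muln2 natrM ler_pM2l//; by have /norm_le1_addr1/andP[] := v_le i.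
pose g : {ffun 'I_p -> 'I_(K.*2.+1)} := [ffun i => inord (n i)].
have gE i : g i = n i :> nat by rewrite ffunE inordK // ltnS n_le.
pose e i : R := grid_vector R g i - v i.
(* A zero coordinate is rounded to exactly zero, so the error stays supported on [S] and the
   extremal bounds apply to it. *)
have nK i : i \notin S -> n i = K.
  move=> iS; apply/eqP; rewrite -(@eqr_nat R) /n vS// add0r mulr1 truncnK//.
have eS : supported S e.
  by move=> i iS; rewrite /e /grid_vector gE nK// vS// divff ?subrr// gt_eqF.
have uE : grid_vector R g = (fun i => v i + e i).
  by apply/funext => i; rewrite /e addrC subrK.
have uS : supported S (grid_vector R g).
  by move=> i iS; rewrite uE vS// eS// addr0.
have e_le i : e i * e i <= (K%:R ^+ 2)^-1.
  have eE : e i = ((n i)%:R - K%:R * (v i + 1)) / K%:R.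
    rewrite /e /grid_vector gE; field; exact: lt0r_neq0.
  rewrite eE mulf_div -expr2 ler_pdivrMr ?mulr_gt0// -expr2 mulVf; last first.
    by rewrite expf_neq0// gt_eqF.
  have := floor_error (nP i).
  move: (K%:R * (v i + 1)) => y /andP[y1 y2].
  by rewrite -sqrrN opprB expr_le1.
(* At most [m] coordinates are in error, each by at most 1/K; hence the requirement that [m] be at
   most (r K)^2. *)
have ee : dotp e e <= r ^+ 2.
  rewrite (dotp_submx _ eS) /dotp.
  apply: (@le_trans _ _ (\sum_(k < #|S|) (K%:R ^+ 2)^-1)).
    by apply: ler_sum => k _; exact: e_le.
  rewrite sumr_const card_ord Sm -[leLHS]mulr_natl ler_pdivrMr ?exprn_gt0//.
  by rewrite -exprMn.
have ve := dotp_le r0 v1 ee.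
have L0 : 0 <= top_lambda m A :=
  ge0_of_opp_le (top_lambda_opp_ge AT BT BA mp) AA.
exists S, g; split; first exact: Sm.
- by move=> i iS; rewrite /g ffunE nK.
- by rewrite uE dotpD v1; exact: (perturbed_sqnorm ve ee).
- rewrite uE (qformD _ _ AT) /qform (vst v vS) (vst e eS) v1 mulr1 -/(qform A e).
  apply: (perturbed_qform L0 ve).
  rewrite -BA; apply: (le_trans (qform_le_top_lambda BT mp Sm eS)).
  apply: (le_trans (ler_wpM2r (dotp_ge0 e) AA)).
  exact: (ler_wpM2l L0 ee).
Qed.

(** The set is recorded together with the grid point, which makes the count a plain product. The
    last condition, satisfied by every rounded unit vector, bounds the variance of the corresponding
    form. *)
Definition grid (R : realType) (m p K : nat) (r : R) :
    {set {set 'I_p} * {ffun 'I_p -> 'I_(K.*2.+1)}} :=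
  [set x : {set 'I_p} * {ffun 'I_p -> 'I_(K.*2.+1)} |
    [&& #|x.1| == m, x.2 \in pffun_on (inord K) (mem x.1) predT &
    dotp (grid_vector R x.2) (grid_vector R x.2) <= (1 + r) ^+ 2]]%SET.

Lemma card_grid (R : realType) (m p K : nat) (r : R) :
  (#|grid m p K r| <= 'C(p, m) * K.*2.+1 ^ m)%N.
Proof.
rewrite -sum1_card.
pose D (S : {set 'I_p}) := (pffun_on (inord K : 'I_(K.*2.+1)) (mem S) predT).
apply: (@leq_trans (\sum_(x : {set 'I_p} * {ffun 'I_p -> 'I_(K.*2.+1)} |
    (#|x.1| == m) && (x.2 \in D x.1)) 1)%N).
  rewrite big_mkcond [leqRHS]big_mkcond; apply: leq_sum => x _.
  by rewrite inE; case: ifP => // /and3P[-> ->].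
rewrite -(pair_big_dep (fun S : {set 'I_p} => #|S| == m)
  (fun S g => g \in D S) (fun _ _ => 1%N))/=.
rewrite (eq_bigr (fun=> K.*2.+1 ^ m)%N); last first.
  move=> S /eqP Sm; rewrite sum1_card card_pffun_on cardT size_enum_ord.
  by congr (_ ^ _)%N.
rewrite sum_nat_const leq_mul2r; apply/orP; right.
by rewrite -[in leqRHS](card_ord p) -card_draws cardsE.
Qed.

(** If the top eigenvalue of - A is the larger one, then it bounds that of [A] and the rounding is
    done for - A instead; the second exponential covers this case. The slope [c] makes up for the
    factor 1 - 2 r - r^2 lost in rounding. *)
Lemma expR_top_lambda_le (R : realType) (m p K : nat) (A : 'M[R]_p) (r b c : R) :
  A^T = A -> (0 < m <= p)%N -> (0 < K)%N -> 0 < r ->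
  m%:R <= (r * K%:R) ^+ 2 -> 0 < 1 - 2 * r - r ^+ 2 -> 0 <= b ->
  c = b / (1 - 2 * r - r ^+ 2) ->
  expR (b * top_lambda m A) <=
  \sum_(x in grid m p K r) (expR (c * qform A (grid_vector R x.2)) +
    expR (- c * qform A (grid_vector R x.2))).
Proof.
move=> AT mp K0 r0 mK k0 b0 cb.
have [B BT BA] : exists2 B : 'M[R]_p, B^T = B & forall u, qform B u = - qform A u.
  by exists (- A); [rewrite linearN/= AT|exact: qform_opp].
have AB u : qform A u = - qform B u by rewrite BA opprK.
have c0 : 0 <= c by rewrite cb divr_ge0// ltW.
have cE (L q : R) : L * (1 - 2 * r - r ^+ 2) <= q -> b * L <= c * q.
  move=> Lq; apply: (le_trans _ (ler_wpM2l c0 Lq)).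
  rewrite le_eqVlt; apply/orP; left; apply/eqP; rewrite cb; field.
  exact: lt0r_neq0.
have term_ge0 (x : {set 'I_p} * {ffun 'I_p -> 'I_(K.*2.+1)}) :
    0 <= expR (c * qform A (grid_vector R x.2)) +
    expR (- c * qform A (grid_vector R x.2)).
  by rewrite addr_ge0// expR_ge0.
have inG (S : {set 'I_p}) (g : {ffun 'I_p -> 'I_(K.*2.+1)}) : #|S| = m ->
    (forall i, i \notin S -> g i = inord K) ->
    dotp (grid_vector R g) (grid_vector R g) <= (1 + r) ^+ 2 ->
    expR (c * qform A (grid_vector R g)) + expR (- c * qform A (grid_vector R g)) <=
    \sum_(x in grid m p K r) (expR (c * qform A (grid_vector R x.2)) +
      expR (- c * qform A (grid_vector R x.2))).
  move=> Sm gS gr; rewrite (bigD1 (S, g))/=.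
    by rewrite lerDl; apply: sumr_ge0 => x _; exact: term_ge0.
  rewrite inE /= Sm eqxx gr andbT /=.
  apply/pffun_onP; split => //; apply/supportP => i iS.
  exact: gS.
have [AA|/ltW AA] := leP (top_lambda m B) (top_lambda m A).
  have [S [g [Sm gS gr gA]]] := grid_approx AT BT BA mp K0 r0 mK AA.
  apply: (le_trans _ (inG _ _ Sm gS gr)); rewrite ler_wpDr ?expR_ge0//.
  by rewrite ler_expR; exact: cE.
have [S [g [Sm gS gr gA]]] := grid_approx BT AT AB mp K0 r0 mK AA.
apply: (le_trans _ (inG _ _ Sm gS gr)); rewrite ler_wpDl ?expR_ge0//.
rewrite ler_expR mulNr -mulrN -BA; apply: (le_trans (ler_wpM2l b0 AA)).
exact: cE.
Qed.

(** * Measurability and symmetry in law *)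

Definition opp_rv (R : realType) (d : measure_display) (T : measurableType d)
    (P : probability T R) (X : {RV P >-> R}) : {RV P >-> R} :=
  (- (X : {mfun T >-> R}))%R.

(** The reflection is written as an affine map to match the affine rule for Gaussian laws. *)
Lemma opp_rv_preimage (R : realType) (d : measure_display) (T : measurableType d)
    (P : probability T R) (X : {RV P >-> R}) (B : set R) :
  opp_rv X @^-1` B = X @^-1` ((fun x => -1 * x + 0) @^-1` B).
Proof. by apply/seteqP; split=> w; rewrite /= addr0 mulN1r. Qed.

Lemma measurable_opp_preimage (R : realType) (B : set R) :
  measurable B -> measurable ((fun x : R => -1 * x + 0) @^-1` B).
Proof.
move=> mB; rewrite -[_ @^-1` _]setTI.
have mf : measurable_fun [set: R] (fun x : R => -1 * x + 0).
  by apply: measurable_funD => //; exact: measurable_funM.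
exact: mf.
Qed.

Lemma has_normal_law_opp (R : realType) (d : measure_display)
    (T : measurableType d) (P : probability T R) (X : {RV P >-> R}) (v : R) :
  0 < v -> has_normal_law X 0 v -> has_normal_law (opp_rv X) 0 v.
Proof.
move=> v0 lawX B mB.
have m1 := measurable_opp_preimage mB.
transitivity (P (X @^-1` ((fun x => -1 * x + 0) @^-1` B))).
  by rewrite -opp_rv_preimage.
transitivity (normal_prob 0 (Num.sqrt v) ((fun x => -1 * x + 0) @^-1` B)).
  exact: (lawX _ m1).
have s0 : Num.sqrt v != 0 by rewrite gt_eqF// sqrtr_gt0.
have n1 : (-1 : R) != 0 by rewrite oppr_eq0 oner_eq0.
rewrite (normal_prob_affine 0 0 n1 s0 mB) mulr0 add0r.
by apply: normal_prob_sqr; rewrite mulN1r ?sqrrN// oppr_eq0.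
Qed.

Lemma mutually_independent_opp (R : realType) (d : measure_display)
    (T : measurableType d) (P : probability T R) (I : finType)
    (X : I -> {RV P >-> R}) :
  mutually_independent X -> mutually_independent (fun i => opp_rv (X i)).
Proof.
move=> indX J B mB.
rewrite (eq_bigcapr (fun i _ => opp_rv_preimage (X i) (B i))).
under [RHS]eq_bigr do rewrite opp_rv_preimage.
by apply: indX => i; exact: measurable_opp_preimage.
Qed.

Lemma gaussian_wigner_opp (R : realType) (d : measure_display)
    (T : measurableType d) (P : probability T R) (p : nat)
    (W : 'I_p -> 'I_p -> {RV P >-> R}) :
  gaussian_wigner W -> gaussian_wigner (fun i j => opp_rv (W i j)).
Proof.
move=> [WC indW diagW offW]; split.
- by move=> i j w; rewrite /opp_rv /= -[LHS]/(- _) -[RHS]/(- _) WC.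
- exact: (mutually_independent_opp indW).
- by move=> i; exact: has_normal_law_opp.
- by move=> i j ij; apply: has_normal_law_opp => //; exact: offW.
Qed.

Lemma random_mx_opp (R : realType) (d : measure_display)
    (T : measurableType d) (P : probability T R) (p : nat)
    (W : 'I_p -> 'I_p -> {RV P >-> R}) (w : T) :
  random_mx (fun i j => opp_rv (W i j)) w = - random_mx W w.
Proof. by apply/matrixP => i j; rewrite !mxE. Qed.

Lemma random_mx_sym (R : realType) (d : measure_display)
    (T : measurableType d) (P : probability T R) (p : nat)
    (W : 'I_p -> 'I_p -> {RV P >-> R}) (w : T) :
  gaussian_wigner W -> (random_mx W w)^T = random_mx W w.
Proof. by move=> [WC _ _ _]; apply/matrixP => i j; rewrite !mxE WC. Qed.

Lemma bilin_norm_le (R : realType) (k : nat) (A : 'M[R]_k) (u e : 'I_k -> R)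
    (a b : R) : 0 <= b -> (forall i, `|u i| <= a) -> (forall i, `|e i| <= b) ->
  `|bilin A u e| <= a * b * \sum_i \sum_j `|A i j|.
Proof.
move=> b0 ua eb; rewrite /bilin mulr_sumr.
apply: (le_trans (ler_norm_sum _ _ _)); apply: ler_sum => i _; rewrite mulr_sumr.
apply: (le_trans (ler_norm_sum _ _ _)); apply: ler_sum => j _.
rewrite !normrM ler_wpM2r// ler_pM//.
Qed.

(** By homogeneity integer vectors stand for rational ones, and these are dense. Rounding [N u] down
    costs O(1/N) in the form after rescaling, and the Archimedean property removes it. The purpose
    is a countable family of test vectors. *)
Lemma qform_integer_nonneg (R : realType) (p : nat) (B : 'M[R]_p) (S : {set 'I_p}) :
  B^T = B ->
  (forall g : 'I_p -> int, (forall i, i \notin S -> g i = 0) ->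
    0 <= qform B (fun i => (g i)%:~R)) ->
  forall u, supported S u -> 0 <= qform B u.
Proof.
move=> BT H u uS.
pose C := \sum_i \sum_j `|B i j|.
have C0 : 0 <= C by apply: sumr_ge0 => i _; exact: sumr_ge0.
(* A bound on the coordinates without square roots: x^2 <= D implies x <= D + 1. *)
pose a := dotp u u + 1.
have ua i : `|u i| <= a.
  have : u i ^+ 2 <= dotp u u.
    rewrite /dotp (bigD1 i)//= -expr2 lerDl.
    by apply: sumr_ge0 => j _; rewrite -expr2 sqr_ge0.
  rewrite -real_normK ?num_real// /a; have := normr_ge0 (u i).
  by move: `|u i| => x x0 xu; have := sqr_ge0 (x - 1); nra.
have a1 : 1 <= a by rewrite lerDr dotp_ge0.
have key n : - ((2 * a + 1) * C) <= qform B u * n.+1%:R.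
  pose N : R := n.+1%:R.
  have N0 : 0 < N by rewrite ltr0n.
  have N1 : 1 <= N by rewrite ler1n.
  pose g i : int := Num.floor (N * u i).
  pose e i : R := (g i)%:~R / N - u i.
  have gP i : (g i)%:~R <= N * u i < (g i)%:~R + 1.
    by have := floor_itv (N * u i); rewrite intrD.
  have eb i : `|e i| <= N^-1.
    have eE : e i = ((g i)%:~R - N * u i) / N by rewrite /e; field; exact: lt0r_neq0.
    rewrite eE normrM [`|N^-1|]gtr0_norm ?invr_gt0//.
    apply: ler_piMl; first by rewrite invr_ge0 ltW.
    have /andP[g1 g2] := gP i.
    by rewrite ler_norml; apply/andP; split; lra.
  have gS i : i \notin S -> g i = 0 by move=> /uS; rewrite /g => ->; rewrite mulr0 floor0.
  have := H g gS.
  have -> : (fun i => (g i)%:~R) = fun i => N * (u i + e i).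
    by apply/funext => i; rewrite /e addrC subrK mulrC divfK// gt_eqF.
  rewrite /qform bilinZ -/(qform B (fun i => u i + e i)) qformD//.
  rewrite pmulr_rge0 ?mulr_gt0// => D.
  have V0 : 0 <= N^-1 by rewrite invr_ge0 ltW.
  have h1 : bilin B u e <= a * N^-1 * C.
    exact: le_trans (ler_norm _) (bilin_norm_le _ V0 ua eb).
  have h2 : qform B e <= N^-1 * N^-1 * C.
    exact: le_trans (ler_norm _) (bilin_norm_le _ V0 eb eb).
  have h3 : N^-1 * N^-1 * C <= N^-1 * C.
    by rewrite ler_wpM2r// ler_piMl// invf_le1.
  have h4 : 0 <= qform B u + (2 * a + 1) * C * N^-1.
    rewrite (_ : _ * C / N = 2 * (a / N * C) + N^-1 * C); last by ring.
    apply: (le_trans D); move: h1 h2 h3; rewrite -/C.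
    move: (bilin B u e) (a / N * C) (N^-1 * C) (N^-1 / N * C) => *; lra.
  have := mulr_ge0 h4 (ltW N0).
  by rewrite mulrDl mulfVK ?gt_eqF//; move: (qform B u * N) (_ * C) => *; lra.
rewrite leNgt; apply/negP => Q0.
pose x := (2 * a + 1) * C / (- qform B u).
have x0 : 0 <= x.
  by apply: divr_ge0; [apply: mulr_ge0 => //; lra|lra].
have /andP[_] := truncn_itv x0; move: (Num.Def.trunc x) => n xn.
have := key n; move: xn; rewrite /x ltr_pdivrMr ?oppr_gt0//.
by move: ((2 * a + 1) * C) n.+1%:R => y N; nra.
Qed.

Lemma measurable_qform (R : realType) (d : measure_display)
    (T : measurableType d) (p : nat) (M : T -> 'M[R]_p) (u : 'I_p -> R) :
  (forall i j, measurable_fun setT (fun w => M w i j)) ->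
  measurable_fun setT (fun w => qform (M w) u).
Proof.
move=> mM; apply: measurable_sum => i; apply: measurable_sum => j.
by apply: measurable_funM => //; exact: measurable_cst.
Qed.

Lemma measurable_le_set (R : realType) (d : measure_display)
    (T : measurableType d) (f : T -> R) (c : R) :
  measurable_fun setT f -> measurable [set w | f w <= c].
Proof.
move=> mf; rewrite -[X in measurable X]setTI
  (_ : [set w | _] = f @^-1` `]-oo, c]%classic).
  by apply: mf => //; exact: measurable_itv.
by apply/seteqP; split=> w /=; rewrite in_itv.
Qed.

(** A sublevel set is a countable intersection, over sets [S] and integer vectors supported on [S],
    of half-spaces in the entries. That integer vectors suffice is the nonnegativity criterion
    applied to [c I - M w]. *)
Lemma measurable_top_lambda (R : realType) (d : measure_display)
    (T : measurableType d) (m p : nat) (M : T -> 'M[R]_p) :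
  (0 < m <= p)%N -> (forall w, (M w)^T = M w) ->
  (forall i j, measurable_fun setT (fun w => M w i j)) ->
  measurable_fun setT (fun w => top_lambda m (M w)).
Proof.
move=> mp MT mM.
have leE c : (fun w => top_lambda m (M w)) @^-1` `]-oo, c] =
    \bigcap_(x in [set x : {set 'I_p} * {ffun 'I_p -> int} |
       #|x.1| = m /\ forall i, i \notin x.1 -> x.2 i = 0])
     [set w | qform (M w) (fun i => (x.2 i)%:~R) <=
        c * dotp (fun i => (x.2 i)%:~R) (fun i => (x.2 i)%:~R)].
  apply/seteqP; split=> w /=; rewrite in_itv/=.
    move=> /(top_lambda_leP _ (MT w) mp) H [S g] /= [Sm gS].
    by apply: (H S) => // i /gS ->.
  move=> H; apply/(top_lambda_leP _ (MT w) mp) => S u Sm uS.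
  pose B := c%:M - M w.
  have BT : B^T = B by rewrite linearB/= tr_scalar_mx MT.
  have BE v : qform B v = c * dotp v v - qform (M w) v.
    rewrite /qform /bilin /dotp mulr_sumr -sumrB; apply: eq_bigr => i _.
    under eq_bigr do rewrite !mxE mulrBr.
    rewrite sumrB; congr (_ - _); rewrite (bigD1 i)//= eqxx mulr1n big1.
      by rewrite addr0; ring.
    by move=> j /negbTE ji; rewrite eq_sym ji mulr0n mulr0.
  rewrite -subr_ge0 -BE; apply: (qform_integer_nonneg BT _ uS) => g gS.
  rewrite BE subr_ge0.
  have := H (S, [ffun i => g i]) => /=.
  have -> : (fun i => ([ffun i0 => g i0] i)%:~R) = (fun i => (g i)%:~R) :> ('I_p -> R).
    by apply/funext => i; rewrite ffunE.
  by apply; split=> // i iS; rewrite ffunE gS.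
have mle c : measurable ((fun w => top_lambda m (M w)) @^-1` `]-oo, c]).
  rewrite leE -[X in measurable X]setCK setC_bigcap bigcup_mkcond.
  apply: measurableC; apply: countable_bigcupT_measurable => [|x].
    exact: countableP.
  case: ifP => // _; apply: measurableC; apply: measurable_le_set.
  exact: measurable_qform.
apply: (measurability (RGenOInfty.G (R := R)) (RGenOInfty.measurableE R)).
move=> _ [_ [c ->] <-]; rewrite setTI.
rewrite -setCitvl preimage_setC; apply: measurableC; exact: mle.
Qed.

(** Two finite measures on the space of families that agree on rectangles agree on the sigma-algebra
    they generate; on rectangles independence reduces the claim to the marginals. *)
Lemma eq_joint_law (R : realType) (I : finType)
    (d1 : measure_display) (T1 : measurableType d1) (P1 : probability T1 R)
    (X : I -> {RV P1 >-> R})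
    (d2 : measure_display) (T2 : measurableType d2) (P2 : probability T2 R)
    (Y : I -> {RV P2 >-> R}) :
  mutually_independent X -> mutually_independent Y ->
  (forall i B, measurable B -> P1 (X i @^-1` B) = P2 (Y i @^-1` B)) ->
  forall A, <<s rectangles (fun i (f : I -> R) => f i) [set: I]%SET >> A ->
    P1 ((fun w i => X i w) @^-1` A) = P2 ((fun w i => Y i w) @^-1` A).
Proof.
move=> indX indY XY A mA.
pose G := rectangles (fun i (f : I -> R) => f i) [set: I]%SET.
pose F := g_sigma_algebraType G.
have mf (d : measure_display) (T : measurableType d) (P : probability T R)
    (Z : I -> {RV P >-> R}) : measurable_fun setT ((fun w i => Z i w) : T -> F).
  apply: (@measurability _ _ T F setT _ G erefl).
  move=> _ [_ [B mB ->] <-]; rewrite setTI preimage_bigcap.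
  apply: fin_bigcap_measurable => // i _.
  exact: measurable_funPTI.
pose X' : {mfun T1 >-> F} := HB.pack ((fun w i => X i w) : T1 -> F)
  (isMeasurableFun.Build _ _ _ _ _ (mf _ _ _ X)).
pose Y' : {mfun T2 >-> F} := HB.pack ((fun w i => Y i w) : T2 -> F)
  (isMeasurableFun.Build _ _ _ _ _ (mf _ _ _ Y)).
transitivity (distribution P1 X' A); first by [].
transitivity (distribution P2 Y' A); last by [].
apply: (@measure_unique _ R F G (fun=> setT)) => //.
- exact: rectangles_setI.
- by move=> _; exact: rectanglesT.
- by apply/seteqP; split=> // w _; exists 0%N.
- move=> _ [B mB ->].
  transitivity (P1 (\bigcap_(i in [set` [set: I]%SET]) (X i @^-1` B i))); first by [].
  transitivity (P2 (\bigcap_(i in [set` [set: I]%SET]) (Y i @^-1` B i))); last by [].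
  rewrite (indX _ _ mB) (indY _ _ mB).
  by apply: eq_bigr => i _; exact: XY.
- by move=> k; apply: le_lt_trans (ltry 1); exact: probability_le1.
Qed.

Lemma measurable_fun_top_lambda (R : realType) (d : measure_display)
    (T : measurableType d) (P : probability T R) (m p : nat)
    (W : 'I_p -> 'I_p -> {RV P >-> R}) :
  (0 < m <= p)%N -> gaussian_wigner W ->
  measurable_fun setT (fun w => top_lambda m (random_mx W w)).
Proof.
move=> mp hW; apply: measurable_top_lambda => //.
  by move=> w; exact: random_mx_sym.
move=> i j; rewrite (_ : (fun w => _) = W i j)//.
by apply/funext => w; rewrite mxE.
Qed.

Lemma wigner_top_lambda_law (R : realType) (d1 : measure_display)
    (T1 : measurableType d1) (P1 : probability T1 R) (d2 : measure_display)
    (T2 : measurableType d2) (P2 : probability T2 R) (m p : nat)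
    (W : 'I_p -> 'I_p -> {RV P1 >-> R}) (W' : 'I_p -> 'I_p -> {RV P2 >-> R}) :
  (0 < m <= p)%N -> gaussian_wigner W -> gaussian_wigner W' ->
  forall B, measurable B ->
    P1 ((fun w => top_lambda m (random_mx W w)) @^-1` B) =
    P2 ((fun w => top_lambda m (random_mx W' w)) @^-1` B).
Proof.
move=> mp [WC indW diagW offW] [WC' indW' diagW' offW'] B mB.
pose I := {ij : 'I_p * 'I_p | (ij.1 <= ij.2)%N}.
(* The symmetric matrix is rebuilt from its upper triangle: entry (i, j) is read at (j, i) when i >
   j. One of the two pairs is always admissible, so the default 0 is never reached. *)
pose M (f : I -> R) : 'M[R]_p := \matrix_(i, j)
  oapp f (oapp f 0 (insub (j, i))) (insub (i, j)).
have MT f : (M f)^T = M f.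
  apply/matrixP => i j; rewrite !mxE.
  case: insubP => [x /= ji xE|/= ji]; case: insubP => [y /= ij yE|/= ij] //=.
  congr f; apply: val_inj; apply: (etrans yE); apply: esym; apply: (etrans xE).
  by have -> : i = j by apply: val_inj; apply/eqP; rewrite eqn_leq ij ji.
have ME (d : measure_display) (T : measurableType d) (P : probability T R)
    (Z : 'I_p -> 'I_p -> {RV P >-> R}) w : (forall i j w, Z i j w = Z j i w) ->
    M (fun x => Z (val x).1 (val x).2 w) = random_mx Z w.
  move=> ZC; apply/matrixP => i j; rewrite !mxE.
  case: (@insubP _ _ I (i, j)) => [x /= _ ->//|/= ij].
  have ji : (j <= i)%N by rewrite leqNgt; apply: contra ij; exact: ltnW.
  by rewrite insubT /= ZC.
pose F := g_sigma_algebraType (rectangles (fun (x : I) (f : I -> R) => f x) [set: I]%SET).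
have mh : measurable_fun setT ((fun f => top_lambda m (M f)) : F -> R).
  have me (x : I) : measurable_fun setT ((fun f => f x) : F -> R).
    move=> _ C mC; rewrite setTI; apply: sub_sigma_algebra.
    by apply: (rectangles_preimage (fun (x : I) (f : I -> R) => f x)); rewrite ?inE.
  apply: measurable_top_lambda => // i j.
  rewrite (_ : (fun f => M f i j) =
    fun f : F => oapp f (oapp f 0 (insub (j, i))) (insub (i, j))); last first.
    by apply/funext => f; rewrite mxE.
  case: (insub (i, j)) => [x|] /=; first exact: (me x).
  by case: (insub (j, i)) => [x|] /=; [exact: (me x)|exact: measurable_cst].
have mA := mh measurableT B mB; rewrite setTI in mA.
have lawE (x : I) C : measurable C ->
    P1 (W (val x).1 (val x).2 @^-1` C) = P2 (W' (val x).1 (val x).2 @^-1` C).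
  case: x => -[i j] /= ij mC.
  have [eij|nij] := eqVneq i j.
    by rewrite -eij; transitivity (normal_prob 0 (Num.sqrt 2) C);
      [exact: diagW|symmetry; exact: diagW'].
  have lt_ij : (i < j)%N by rewrite ltn_neqAle ij andbT.
  transitivity (normal_prob 0 (Num.sqrt 1) C); first exact: offW.
  by symmetry; exact: offW'.
have := eq_joint_law indW indW' lawE mA.
rewrite (_ : _ @^-1` _ = (fun w => top_lambda m (random_mx W w)) @^-1` B); last first.
  by apply/seteqP; split=> w /=; rewrite ME.
rewrite (_ : _ @^-1` (_ @^-1` _) = (fun w => top_lambda m (random_mx W' w)) @^-1` B)//.
by apply/seteqP; split=> w /=; rewrite ME.
Qed.

Lemma same_distribution_extreme (R : realType) (d : measure_display)
    (T : measurableType d) (P : probability T R) (m p : nat)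
    (W : 'I_p -> 'I_p -> {RV P >-> R}) :
  (0 < m <= p)%N -> gaussian_wigner W ->
  same_distribution P (fun w => - max_lambda m (random_mx W w))
    (fun w => min_lambda m (random_mx W w)).
Proof.
move=> mp hW; under eq_fun do rewrite -top_lambdaE.
have hWN := gaussian_wigner_opp hW.
have mT := measurable_fun_top_lambda mp hW.
have mTN := measurable_fun_top_lambda mp hWN.
have VE : (fun w => min_lambda m (random_mx W w)) = (fun w =>
    - top_lambda m (random_mx (fun i j => opp_rv (W i j)) w)).
  by apply/funext => w; rewrite random_mx_opp min_lambda_opp.
rewrite VE; split; [exact: measurable_funN|exact: measurable_funN|].
move=> B mB; have mB' := measurable_opp_preimage mB.
have E (f : T -> R) : (fun w => - f w) @^-1` B = f @^-1` ((fun x => -1 * x + 0) @^-1` B).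
  by apply/seteqP; split=> w /=; rewrite addr0 mulN1r.
rewrite !E; exact: wigner_top_lambda_law.
Qed.

(** * Exponential moments of the largest eigenvalue *)

Lemma qform_random_mx (R : realType) (d : measure_display)
    (T : measurableType d) (P : probability T R) (p : nat)
    (W : 'I_p -> 'I_p -> {RV P >-> R}) (u : 'I_p -> R) (w : T) :
  qform (random_mx W w) u = \sum_i \sum_j (u i * u j) * W i j w.
Proof. by apply: eq_bigr => i _; apply: eq_bigr => j _; rewrite mxE. Qed.

Lemma sum_sqr_prod (R : realType) (p : nat) (u : 'I_p -> R) :
  \sum_i \sum_j (u i * u j) ^+ 2 = dotp u u ^+ 2.
Proof.
rewrite expr2 [in RHS]/dotp mulr_suml; apply: eq_bigr => i _.
by rewrite mulr_sumr; apply: eq_bigr => j _; ring.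
Qed.

Lemma measurable_qform_random_mx (R : realType) (d : measure_display)
    (T : measurableType d) (P : probability T R) (p : nat)
    (W : 'I_p -> 'I_p -> {RV P >-> R}) (u : 'I_p -> R) :
  measurable_fun setT (fun w => qform (random_mx W w) u).
Proof.
apply: measurable_qform => i j; rewrite (_ : (fun w => _) = W i j)//.
by apply/funext => w; rewrite mxE.
Qed.

Lemma wigner_qform_law (R : realType) (d : measure_display)
    (T : measurableType d) (P : probability T R) (p : nat)
    (W : 'I_p -> 'I_p -> {RV P >-> R}) (u : 'I_p -> R) :
  gaussian_wigner W -> 0 < dotp u u ->
  forall B, measurable B ->
    P ((fun w => qform (random_mx W w) u) @^-1` B) =
    normal_prob 0 (Num.sqrt (2 * dotp u u ^+ 2)) B.
Proof.
move=> hW u0 B mB; rewrite -sum_sqr_prod -(wigner_quadratic_law hW)//.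
- rewrite (_ : (fun w => qform _ _) = fun w => \sum_i \sum_j (u i * u j) * W i j w)//.
  by apply/funext => w; exact: qform_random_mx.
- by move=> i j; rewrite mulrC.
- by rewrite sum_sqr_prod exprn_gt0.
Qed.

Lemma wigner_qform_mgf (R : realType) (d : measure_display)
    (T : measurableType d) (P : probability T R) (p : nat)
    (W : 'I_p -> 'I_p -> {RV P >-> R}) (u : 'I_p -> R) (c : R) :
  gaussian_wigner W ->
  (\int[P]_w (expR (c * qform (random_mx W w) u))%:E =
   (expR (c ^+ 2 * dotp u u ^+ 2))%:E)%E.
Proof.
(* The zero vector does occur in the grid; its form has variance 0, so the formula is checked
   directly. *)
move=> hW; have [u0|u0] := eqVneq (dotp u u) 0.
  have uE := dotp_eq0 u0.
  have E w : qform (random_mx W w) u = 0.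
    by rewrite /qform /bilin big1// => i _; rewrite big1// => j _; rewrite uE !mul0r.
  under eq_integral do rewrite E mulr0.
  rewrite integral_cst// u0 expr0n mulr0 -[X in (_ * X)%E]/(P setT).
  by rewrite probability_setT mule1.
have u_gt0 : 0 < dotp u u by rewrite lt_def u0 dotp_ge0.
have s_gt0 : 0 < 2 * dotp u u ^+ 2 by rewrite mulr_gt0// exprn_gt0.
rewrite (normal_mgf c (measurable_qform_random_mx W u) _ (wigner_qform_law hW u_gt0)).
  by rewrite sqr_sqrtr ?ltW//; congr ((expR _)%:E); field.
by rewrite gt_eqF// sqrtr_gt0.
Qed.

Lemma wigner_top_lambda_mgf_le (R : realType) (d : measure_display)
    (T : measurableType d) (P : probability T R) (m p K : nat)
    (W : 'I_p -> 'I_p -> {RV P >-> R}) (r b : R) :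
  gaussian_wigner W -> (0 < m <= p)%N -> (0 < K)%N -> 0 < r ->
  m%:R <= (r * K%:R) ^+ 2 -> 0 < 1 - 2 * r - r ^+ 2 -> 0 <= b ->
  (\int[P]_w (expR (b * top_lambda m (random_mx W w)))%:E <=
   (2 * ('C(p, m) * K.*2.+1 ^ m)%:R *
    expR ((b / (1 - 2 * r - r ^+ 2)) ^+ 2 * (1 + r) ^+ 4))%:E)%E.
Proof.
move=> hW mp K0 r0 mK k0 b0; pose c := b / (1 - 2 * r - r ^+ 2); rewrite -/c.
pose q (x : {set 'I_p} * {ffun 'I_p -> 'I_(K.*2.+1)}) (w : T) :=
  qform (random_mx W w) (grid_vector R x.2).
have mq x : measurable_fun setT (q x) by exact: measurable_qform_random_mx.
pose F x w := ((expR (c * q x w))%:E + (expR (- c * q x w))%:E)%E.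
have mF x : measurable_fun setT (F x).
  by apply: emeasurable_funD; exact: measurable_expR_scale.
have E0 x a w : (0 <= (expR (a * q x w))%:E)%E by rewrite lee_fin expR_ge0.
have F0 x w : (0 <= F x w)%E by rewrite adde_ge0.
apply: (@le_trans _ _ (\int[P]_w (\sum_(x in grid m p K r) F x w)%E)%E).
  apply: ge0_le_integral => //.
  - apply: measurable_expR_scale; exact: measurable_fun_top_lambda.
  - under eq_fun do rewrite big_mkcond.
    by apply: emeasurable_sum => x; case: (x \in grid m p K r).
  - move=> w _.
    have := expR_top_lambda_le (random_mx_sym w hW) mp K0 r0 mK k0 b0 (erefl c).
    by rewrite -lee_fin -sumEFin.
under eq_integral do rewrite -big_enum.
rewrite ge0_integral_sum// big_enum /=.
have FE x : x \in grid m p K r ->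
    (\int[P]_w F x w <= (2 * expR (c ^+ 2 * (1 + r) ^+ 4))%:E)%E.
  rewrite inE => /and3P[_ _ xr].
  rewrite ge0_integralD//; [|exact: measurable_expR_scale..].
  rewrite !wigner_qform_mgf// sqrrN -EFinD lee_fin.
  have : expR (c ^+ 2 * dotp (grid_vector R x.2) (grid_vector R x.2) ^+ 2) <=
      expR (c ^+ 2 * (1 + r) ^+ 4).
    rewrite ler_expR ler_wpM2l ?sqr_ge0// (_ : 4 = 2 * 2)%N// exprM.
    by rewrite ler_pXn2r// ?nnegrE ?dotp_ge0 ?sqr_ge0.
  lra.
apply: (@le_trans _ _ (\sum_(x in grid m p K r) (2 * expR (c ^+ 2 * (1 + r) ^+ 4))%:E)%E).
  exact: lee_sum.
rewrite sumEFin lee_fin sumr_const -[leLHS]mulr_natl mulrCA mulrA.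
rewrite ler_wpM2r ?expR_ge0// ler_wpM2l// ler_nat.
exact: card_grid.
Qed.

(** * Lower tail by the second moment method *)

(** The quotient of the two binomials is the product of the ratios (m - i) / (p - i) for i < a, and
    each is at most m / p. *)
Lemma bin_sub_pow_le (p m a : nat) : (a <= m)%N -> (m <= p)%N ->
  ('C(p - a, m - a) * p ^ a <= 'C(p, m) * m ^ a)%N.
Proof.
move=> am mp; elim: a am => [|a IH] am; first by rewrite !subn0 !expn0.
have pa : (0 < p - a)%N by rewrite subn_gt0 (leq_trans am).
rewrite -(leq_pmul2l pa) !expnS.
have E : ((p - a) * 'C(p - a.+1, m - a.+1) = (m - a) * 'C(p - a, m - a))%N.
  have -> : (p - a = (p - a.+1).+1)%N by rewrite subnSK// (leq_trans am).
  have -> : (m - a = (m - a.+1).+1)%N by rewrite subnSK.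
  by rewrite mul_bin_diag.
rewrite mulnA E.
apply: (@leq_trans (m * (p - a) * ('C(p - a, m - a) * p ^ a))%N).
  rewrite [X in (X <= _)%N](_ : _ = ((m - a) * p) * ('C(p - a, m - a) * p ^ a))%N;
    last by ring.
  rewrite leq_mul2r; apply/orP; right; rewrite mulnBl mulnBr leq_sub2l//.
  by rewrite mulnC leq_mul2l mp orbT.
rewrite [X in (_ <= X)%N](_ : _ = m * (p - a) * ('C(p, m) * m ^ a))%N; last by ring.
by rewrite leq_mul2l IH ?orbT// ltnW.
Qed.

(** Removing [A] injects the sets counted into the subsets of size m - |A| of its complement. Thus a
    uniform m-set contains [A] with probability at most (m / p)^|A|. *)
Lemma card_supersets_le (p m : nat) (A : {set 'I_p}) : (m <= p)%N ->
  (#|[set S : {set 'I_p} | (A \subset S) && (#|S| == m)]%SET| * p ^ #|A| <=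
   'C(p, m) * m ^ #|A|)%N.
Proof.
move=> mp; set D := [set S : {set 'I_p} | _]%SET.
have [Am|mA] := leqP #|A| m; last first.
  have -> : D = finset.set0.
    apply/setP => S; rewrite !inE; apply/negbTE/negP => /andP[/subset_leq_card AS /eqP Sm].
    by move: AS; rewrite Sm leqNgt mA.
  by rewrite finset.cards0.
apply: leq_trans (bin_sub_pow_le Am mp); rewrite leq_mul2r; apply/orP; right.
have inj : {in D &, injective (fun S : {set 'I_p} => S :\: A)}.
  move=> S S'; rewrite !inE => /andP[AS _] /andP[AS' _] SS'.
  rewrite -(finset.setID S A) -(finset.setID S' A) SS'.
  by rewrite !(finset.setIidPr _).
rewrite -(card_in_imset inj).
have -> : (p - #|A| = #|~: A|)%N.
  have := cardsC A; rewrite card_ord => E; apply/eqP; rewrite -(eqn_add2l #|A|) E subnKC//.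
  by rewrite (leq_trans (max_card _))// card_ord.
rewrite -cards_draws; apply: subset_leq_card; apply/fintype.subsetP => B.
move=> /imsetP[S]; rewrite !inE => /andP[AS /eqP Sm] ->; apply/andP; split.
  by apply/fintype.subsetP => i; rewrite !inE => /andP[].
by rewrite cardsD (finset.setIidPr _)// Sm.
Qed.

Lemma integral_sum_indic (R : realType) (d : measure_display)
    (T : measurableType d) (P : probability T R) (I : finType) (c : R)
    (E : I -> set T) : 0 <= c -> (forall i, measurable (E i)) ->
  (\int[P]_w (c * \sum_i \1_(E i) w)%:E = (c * \sum_i fine (P (E i)))%:E)%E.
Proof.
move=> c0 mE.
have mi i : measurable_fun setT (fun w => (\1_(E i) w)%:E : \bar R).
  exact/measurable_EFinP/measurable_indic.
have i0 i w : (0 <= (\1_(E i) w)%:E :> \bar R)%E by rewrite lee_fin.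
under eq_integral do rewrite EFinM -sumEFin.
rewrite ge0_integralZl//.
- rewrite ge0_integral_sum// EFinM -sumEFin; congr (_ * _)%E.
  apply: eq_bigr => i _; rewrite integral_indic// setIT fineK//.
  exact: fin_num_measure.
- exact: emeasurable_sum.
- by move=> w _; apply: sume_ge0.
Qed.

(* Chebyshev's inequality for the number of events that occur. *)
Lemma second_moment (R : realType) (d : measure_display)
    (T : measurableType d) (P : probability T R) (F : finType)
    (E : F -> set T) (q : R) : (forall s, measurable (E s)) ->
  (forall s, P (E s) = q%:E) ->
  fine (P (\bigcap_s ~` E s)) * (#|F|%:R * q) ^+ 2 <=
  \sum_s \sum_s' fine (P (E s `&` E s')) - (#|F|%:R * q) ^+ 2.
Proof.
move=> mE PE; pose N : R := #|F|%:R * q.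
have N0 : 0 <= N.
  rewrite /N; have [->|] := posnP #|F|; first by rewrite mul0r.
  by move=> /card_gt0P[s _]; rewrite mulr_ge0// -lee_fin -(PE s).
pose A := \bigcap_s ~` E s.
have mA : measurable A.
  by apply: fin_bigcap_measurable => // s _; exact: measurableC.
have A1 : (\int[P]_w (N ^+ 2 * \sum_(i : 'I_1) \1_A w)%:E =
    (N ^+ 2 * \sum_(i : 'I_1) fine (P A))%:E)%E.
  by rewrite (integral_sum_indic P (E := fun _ : 'I_1 => A)) ?sqr_ge0.
have A2 := integral_sum_indic P (mulr_ge0 (ler0n R 2) N0) mE.
have mEE (x : F * F) : measurable (E x.1 `&` E x.2) by exact: measurableI.
have A3 := integral_sum_indic P (@ler01 R) mEE.
have A4 : (\int[P]_w (N ^+ 2 * \sum_(i : 'I_1) \1_setT w)%:E =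
    (N ^+ 2 * \sum_(i : 'I_1) fine (P setT))%:E)%E.
  by rewrite (integral_sum_indic P (E := fun _ : 'I_1 => setT)) ?sqr_ge0.
have msum (I : finType) (c : R) (G : I -> set T) : (forall i, measurable (G i)) ->
    measurable_fun setT (fun w => (c * \sum_i \1_(G i) w)%:E : \bar R).
  move=> mG; apply/measurable_EFinP; apply: measurable_funM => //.
  by apply: measurable_sum => i; exact: measurable_indic.
have sum0 (I : finType) (c : R) (G : I -> set T) w : 0 <= c ->
    (0 <= (c * \sum_i \1_(G i) w)%:E :> \bar R)%E.
  by move=> c0; rewrite lee_fin mulr_ge0// sumr_ge0.
(* With Y the number of events that occur, this integrates N^2 1_A + 2 N Y <= Y^2 + N^2. On [A] one
   has Y = 0, and elsewhere it is (Y - N)^2 >= 0. All terms are nonnegative, so no subtraction of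
   extended reals occurs. *)
have : ((\int[P]_w (N ^+ 2 * \sum_(i : 'I_1) \1_A w)%:E +
         \int[P]_w (2 * N * \sum_s \1_(E s) w)%:E <=
         \int[P]_w (1 * \sum_(x : F * F) \1_(E x.1 `&` E x.2) w)%:E +
         \int[P]_w (N ^+ 2 * \sum_(i : 'I_1) \1_setT w)%:E)%E).
  have N2 : 0 <= N ^+ 2 by exact: sqr_ge0.
  have TN : 0 <= 2 * N by rewrite mulr_ge0.
  have m1 := msum 'I_1 (N ^+ 2) (fun=> A) (fun=> mA).
  have m2 := msum F (2 * N) E mE.
  have m3 := msum (F * F)%type 1 (fun x => E x.1 `&` E x.2) mEE.
  have m4 := msum 'I_1 (N ^+ 2) (fun=> setT) (fun=> measurableT).
  rewrite -ge0_integralD//; [|by move=> w _; apply: sum0..].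
  rewrite -ge0_integralD//; [|by move=> w _; apply: sum0..].
  apply: ge0_le_integral => //.
  - by move=> w _; rewrite adde_ge0// sum0.
  - exact: emeasurable_funD.
  - exact: emeasurable_funD.
  - move=> w _; rewrite -!EFinD lee_fin !big_ord1 mul1r.
    rewrite -(pair_big xpredT xpredT (fun s s' => \1_(E s `&` E s') w))/=.
    have -> : \sum_s \sum_s' \1_(E s `&` E s') w = (\sum_s \1_(E s) w) ^+ 2 :> R.
      rewrite expr2 mulr_suml; apply: eq_bigr => s _; rewrite mulr_sumr.
      by apply: eq_bigr => s' _; rewrite indicI.
    rewrite indicT mulr1 indicE; case: (boolP (w \in A)) => [wA|_].
      have -> : \sum_s \1_(E s) w = 0 :> R.
        rewrite big1// => s _; rewrite indicE memNset//.
        by move: wA; rewrite inE; apply.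
      by rewrite expr0n /= mulr0 addr0 add0r mulr1.
    rewrite mulr0 add0r; move: (\sum_s _) => x.
    by have := sqr_ge0 (x - N); lra.
rewrite A1 A2 A3 A4 -!EFinD lee_fin !big_ord1 mul1r probability_setT /= mulr1.
rewrite -(pair_big xpredT xpredT (fun s s' => fine (P (E s `&` E s'))))/=.
under [X in _ + 2 * N * X]eq_bigr do rewrite PE.
rewrite sumr_const -[q *+ _]mulr_natl -/N.
rewrite -/A -/N; move: (\sum_s _) (fine _) => x y; lra.
Qed.

Definition indv (R : realType) (p : nat) (S : {set 'I_p}) (i : 'I_p) : R :=
  (i \in S)%:R.

Lemma dotp_indv (R : realType) (p : nat) (S S' : {set 'I_p}) :
  dotp (indv R S) (indv R S') = #|S :&: S'|%:R.
Proof.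
rewrite /dotp /indv -sum1_card natr_sum [RHS]big_mkcond /=; apply: eq_bigr => i _.
by rewrite inE; case: (i \in S); case: (i \in S'); rewrite /= ?mulr1 ?mulr0.
Qed.

Lemma indv_supported (R : realType) (p : nat) (S : {set 'I_p}) :
  supported S (indv R S).
Proof. by move=> i /negbTE iS; rewrite /indv iS. Qed.

(** Disjoint sets of indices involve disjoint groups of entries; such pairs contribute nothing to
    the variance of the count. *)
Lemma qform_indv_disjoint (R : realType) (d : measure_display)
    (T : measurableType d) (P : probability T R) (p : nat)
    (W : 'I_p -> 'I_p -> {RV P >-> R}) (S S' : {set 'I_p}) (B B' : set R) :
  gaussian_wigner W -> (S :&: S')%SET = finset.set0 ->
  measurable B -> measurable B' ->
  (P ((fun w => qform (random_mx W w) (indv R S)) @^-1` B `&`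
      (fun w => qform (random_mx W w) (indv R S')) @^-1` B') =
   P ((fun w => qform (random_mx W w) (indv R S)) @^-1` B) *
   P ((fun w => qform (random_mx W w) (indv R S')) @^-1` B'))%E.
Proof.
move=> [WC indW _ _] SS' mB mB'.
pose I := {ij : 'I_p * 'I_p | (ij.1 <= ij.2)%N}.
pose X (x : I) := W (val x).1 (val x).2.
pose J (S : {set 'I_p}) := [set x : I | ((val x).1 \in S) && ((val x).2 \in S)]%SET.
pose c (x : I) : R := (if (val x).1 == (val x).2 then 1 else 2)%N%:R.
have qE (Q : {set 'I_p}) : (fun w => qform (random_mx W w) (indv R Q)) =
    fun w => \sum_(x in J Q) c x * X x w.
  apply/funext => w; rewrite qform_random_mx sum_symmetric; last first.
    by move=> i j; rewrite WC (mulrC (indv R Q i)).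
  rewrite [RHS]big_mkcond; apply: eq_bigr => x _; rewrite inE /indv /c.
  case: (_ \in Q); case: (_ \in Q) => /=; rewrite ?mul0r ?mulr0 ?mul0r ?mul0rn//.
  by rewrite !mul1r mulr_natl.
rewrite !qE.
apply: (mutually_independent_groups indW (J := J S) (K := J S')).
- move=> x; rewrite !inE => /andP[xS _]; apply/negP => /andP[xS' _].
  have : (val x).1 \in (S :&: S')%SET by rewrite inE xS xS'.
  by rewrite SS' inE.
- exact: measurable_rectangles_comb.
- exact: measurable_rectangles_comb.
Qed.

(** If both forms exceed m t, their sum exceeds 2 m t. The sum is a single Gaussian of variance 4
    (m^2 + k^2), where k is the overlap, so a one-dimensional tail bound replaces the bivariate
    law. *)
Lemma qform_indv_pair_tail (R : realType) (d : measure_display)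
    (T : measurableType d) (P : probability T R) (m p : nat)
    (W : 'I_p -> 'I_p -> {RV P >-> R}) (S S' : {set 'I_p}) (t : R) :
  gaussian_wigner W -> (0 < m)%N -> #|S| = m -> #|S'| = m -> 0 <= t ->
  (P ([set w | m%:R * t <= qform (random_mx W w) (indv R S)]%R `&`
      [set w | m%:R * t <= qform (random_mx W w) (indv R S')]%R) <=
   (expR (- (m%:R ^+ 2 * t ^+ 2 /
      (2 * (m%:R ^+ 2 + #|S :&: S'|%:R ^+ 2)))))%:E)%E.
Proof.
move=> hW m0 Sm S'm t0.
pose k : R := #|S :&: S'|%:R; rewrite -/k.
pose a i j : R := indv R S i * indv R S j + indv R S' i * indv R S' j.
pose Y w := \sum_i \sum_j a i j * W i j w.
have YE w : Y w = qform (random_mx W w) (indv R S) + qform (random_mx W w) (indv R S').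
  rewrite !qform_random_mx -big_split; apply: eq_bigr => i _.
  by rewrite -big_split; apply: eq_bigr => j _; rewrite mulrDl.
have mR : 0 < m%:R :> R by rewrite ltr0n.
have a2 : \sum_i \sum_j a i j ^+ 2 = 2 * (m%:R ^+ 2 + k ^+ 2).
  transitivity (\sum_i \sum_j (indv R S i * indv R S j) ^+ 2 +
      \sum_i \sum_j (indv R S' i * indv R S' j) ^+ 2 +
      2 * ((\sum_i indv R S i * indv R S' i) * (\sum_i indv R S i * indv R S' i))).
    rewrite mulr_suml mulr_sumr -!big_split; apply: eq_bigr => i _ /=.
    rewrite mulr_sumr mulr_sumr -!big_split; apply: eq_bigr => j _ /=.
    by rewrite /a; ring.
  rewrite !sum_sqr_prod -/(dotp (indv R S) (indv R S')) !dotp_indv.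
  by rewrite !finset.setIid Sm S'm -/k; ring.
have a_gt0 : 0 < \sum_i \sum_j a i j ^+ 2.
  by rewrite a2 mulr_gt0// ltr_pwDl ?sqr_ge0// exprn_gt0.
have aC i j : a i j = a j i by rewrite /a (mulrC (indv R S i)) (mulrC (indv R S' i)).
have mY : measurable_fun setT Y.
  rewrite (_ : Y = (fun w => qform (random_mx W w) (indv R S)) \+
    (fun w => qform (random_mx W w) (indv R S'))); last by apply/funext.
  by apply: measurable_funD; exact: measurable_qform_random_mx.
have lawY := wigner_quadratic_law hW aC a_gt0.
have s_gt0 : 0 < 2 * \sum_i \sum_j a i j ^+ 2 by rewrite mulr_gt0.
have s0 : Num.sqrt (2 * \sum_i \sum_j a i j ^+ 2) != 0 by rewrite gt_eqF// sqrtr_gt0.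
have t2 : 0 <= 2 * (m%:R * t) by rewrite !mulr_ge0// ltW.
have := normal_tail_le mY s0 t2 lawY.
have mq Q : measurable [set w | m%:R * t <= qform (random_mx W w) (indv R Q)].
  rewrite -[X in measurable X]setTI (_ : [set w | _] =
    (fun w => qform (random_mx W w) (indv R Q)) @^-1` `[m%:R * t, +oo[%classic).
    by apply: (measurable_qform_random_mx W (indv R Q)) => //; exact: measurable_itv.
  by apply/seteqP; split=> w /=; rewrite in_itv/= andbT.
have mYt : measurable [set w | 2 * (m%:R * t) <= Y w].
  rewrite -[X in measurable X]setTI (_ : [set w | _] =
    Y @^-1` `[2 * (m%:R * t), +oo[%classic).
    by apply: mY => //; exact: measurable_itv.
  by apply/seteqP; split=> w /=; rewrite in_itv/= andbT.
move=> H; apply: le_trans (le_trans H _).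
  apply: le_measure; rewrite ?inE//; first exact: measurableI.
  by move=> w /= [h1 h2]; rewrite YE mulr_natl mulr2n; exact: lerD.
rewrite lee_fin ler_expR (sqr_sqrtr (ltW s_gt0)) a2 le_eqVlt; apply/orP; left; apply/eqP.
field.
by rewrite gt_eqF// ltr_pwDl ?sqr_ge0// exprn_gt0.
Qed.

(* [S :&: S'] is one of the nonempty subsets [A] of [S], and it lies in [S'];
   summing over all such [A] replaces the exact hypergeometric count. *)
Lemma sum_le_subsets (R : realType) (p m : nat) (g : nat -> R) (b : R)
    (S : {set 'I_p}) : #|S| = m -> (0 < m <= p)%N -> (forall k, 0 <= g k) ->
  (forall k, (0 < k <= m)%N -> g k * (m%:R / p%:R) ^+ k <= b) ->
  \sum_(S' : {set 'I_p} | (#|S'| == m) && (S :&: S' != finset.set0)%SET)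
    g #|S :&: S'| <= 2 ^+ m * 'C(p, m)%:R * b.
Proof.
move=> Sm /andP[m0 mp] g0 gb.
have pR : 0 < p%:R :> R by rewrite ltr0n (leq_trans m0).
have b0 : 0 <= b.
  by apply: le_trans (gb 1%N _) => //; rewrite mulr_ge0// exprn_ge0// divr_ge0.
pose D := [set A : {set 'I_p} | (A \subset S) && (A != finset.set0)]%SET.
apply: (@le_trans _ _ (\sum_(S' : {set 'I_p} | #|S'| == m)
    \sum_(A in D) (A \subset S')%:R * g #|A|)).
  rewrite big_mkcondr; apply: ler_sum => S' S'm.
  have t0 A : 0 <= (A \subset S')%:R * g #|A| by rewrite mulr_ge0.
  case: ifPn => SS'; last by apply: sumr_ge0.
  rewrite (bigD1 (S :&: S')%SET)/=; last by rewrite inE finset.subsetIl.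
  by rewrite finset.subsetIr mul1r lerDl sumr_ge0.
rewrite exchange_big /=.
apply: (@le_trans _ _ (\sum_(A in D) 'C(p, m)%:R * b)); last first.
  rewrite sumr_const -[leLHS]mulr_natl mulrA ler_wpM2r// ler_wpM2r//.
  rewrite -natrX ler_nat -Sm -card_powerset; apply: subset_leq_card.
  by apply/fintype.subsetP => A; rewrite !inE => /andP[].
apply: ler_sum => A; rewrite inE => /andP[AS A0].
have A1 : (0 < #|A| <= m)%N by rewrite card_gt0 A0 -Sm subset_leq_card.
rewrite -mulr_suml.
have -> : \sum_(S' : {set 'I_p} | #|S'| == m) (A \subset S')%:R =
    #|[set S' : {set 'I_p} | (A \subset S') && (#|S'| == m)]%SET|%:R :> R.
  rewrite -sum1_card natr_sum big_mkcond [RHS]big_mkcond; apply: eq_bigr => S' _.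
  by rewrite inE; case: (A \subset S'); case: (_ == m).
have := card_supersets_le A mp; rewrite -(ler_nat R) !natrM !natrX => H.
have H2 : #|[set S' : {set 'I_p} | (A \subset S') && (#|S'| == m)]%SET|%:R <=
    'C(p, m)%:R * (m%:R / p%:R) ^+ #|A| :> R.
  by rewrite expr_div_n mulrA ler_pdivlMr ?exprn_gt0//.
apply: (le_trans (ler_wpM2r (g0 _) H2)); rewrite -mulrA ler_wpM2l//.
by rewrite mulrC gb.
Qed.

(** The number [b] bounds, for each overlap k, the joint tail times the weight (m / p)^k of sharing
    k given indices, and [q0] is a lower bound for the probability that one given set succeeds. In
    the second moment bound the factors ['C(p, m)] cancel. *)
Lemma wigner_lower_tail (R : realType) (d : measure_display)
    (T : measurableType d) (P : probability T R) (m p : nat)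
    (W : 'I_p -> 'I_p -> {RV P >-> R}) (t e b q0 : R) :
  gaussian_wigner W -> (0 < m <= p)%N -> 0 <= t -> 0 < e ->
  q0 = e * normal_peak (Num.sqrt 2) * expR (- ((t + e) ^+ 2 / 4)) ->
  (forall k, (0 < k <= m)%N ->
    expR (- (m%:R ^+ 2 * t ^+ 2 / (2 * (m%:R ^+ 2 + k%:R ^+ 2)))) *
    (m%:R / p%:R) ^+ k <= b) ->
  (P [set w | (top_lambda m (random_mx W w) < t)%R] <= (2 ^+ m * b / q0 ^+ 2)%:E)%E.
Proof.
move=> hW mp t0 e0 q0E gb; have /andP[m0 mp'] := mp.
have mR : 0 < m%:R :> R by rewrite ltr0n.
pose D := [set S : {set 'I_p} | #|S| == m]%SET.
pose F : finType := {S in D}.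
have FD (s : F) : #|val s| = m by have := valP s; rewrite inE => /eqP.
pose X (S : {set 'I_p}) w := qform (random_mx W w) (indv R S).
pose E (s : F) := [set w | m%:R * t <= X (val s) w].
have mX S : measurable_fun setT (X S) by exact: measurable_qform_random_mx.
have EE (s : F) : E s = X (val s) @^-1` `[m%:R * t, +oo[%classic.
  by apply/seteqP; split=> w /=; rewrite in_itv/= andbT.
have mE s : measurable (E s).
  by rewrite EE -[_ @^-1` _]setTI; apply: mX => //; exact: measurable_itv.
pose q := fine (normal_prob 0 (m%:R * Num.sqrt 2) `[m%:R * t, +oo[%classic).
have sq2 : 0 < Num.sqrt 2 :> R by rewrite sqrtr_gt0.
have PE s : P (E s) = q%:E.
  have d_gt0 : 0 < dotp (indv R (val s)) (indv R (val s)).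
    by rewrite dotp_indv finset.setIid FD.
  rewrite EE (wigner_qform_law hW d_gt0 (measurable_itv _)).
  rewrite dotp_indv finset.setIid FD /q fineK; last first.
    by apply: fin_num_measure; exact: measurable_itv.
  apply: normal_prob_sqr; last by rewrite gt_eqF// sqrtr_gt0 mulr_gt0// exprn_gt0.
  by rewrite exprMn !sqr_sqrtr ?mulr_ge0 ?sqr_ge0// mulrC.
have q0_gt0 : 0 < q0.
  by rewrite q0E !mulr_gt0 ?expR_gt0// normal_peak_gt0// gt_eqF.
have q0q : q0 <= q.
  rewrite -lee_fin /q fineK; last by apply: fin_num_measure; exact: measurable_itv.
  (* The window is scaled to width m e: the factor m cancels the 1/m in the peak of the law of
     deviation m sqrt 2. *)
  apply: le_trans (normal_tail_ge (mulr_gt0 mR sq2) (mulr_ge0 (ltW mR) t0)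
    (mulr_gt0 mR e0)).
  rewrite lee_fin q0E -mulrDr !exprMn sqr_sqrtr// le_eqVlt; apply/orP; left; apply/eqP.
  congr (_ * expR _); last by field; exact: lt0r_neq0.
  rewrite /normal_peak exprMn sqr_sqrtr//.
  have -> : m%:R ^+ 2 * 2 * pi *+ 2 = m%:R ^+ 2 * (2 * pi *+ 2) :> R by ring.
  rewrite sqrtrM ?sqr_ge0// sqrtr_sqr gtr0_norm//.
  have : Num.sqrt (2 * pi *+ 2) != 0 :> R.
    by rewrite gt_eqF// sqrtr_gt0 mulrn_wgt0// mulr_gt0// pi_gt0.
  move: (Num.sqrt _) => y y0; field.
  by rewrite y0 gt_eqF.
have sumF (f : {set 'I_p} -> R) :
    \sum_(s : F) f (val s) = \sum_(S : {set 'I_p} | #|S| == m) f S.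
  by rewrite -(big_sub _ (fun S => f S)); apply: eq_bigl => S; rewrite inE.
have FE : #|F|%:R = 'C(p, m)%:R :> R.
  rewrite -sum1_card natr_sum -[LHS]/(\sum_(s : F) (fun=> 1) (val s)) sumF.
  rewrite (eq_bigl [in D]); last by move=> S; rewrite inE.
  by rewrite sumr_const card_draws card_ord.
have C_gt0 : 0 < 'C(p, m)%:R :> R by rewrite ltr0n bin_gt0.
pose g (k : nat) : R := expR (- (m%:R ^+ 2 * t ^+ 2 / (2 * (m%:R ^+ 2 + k%:R ^+ 2)))).
have g0 k : 0 <= g k by exact: expR_ge0.
(* The term q^2 is subtracted pair by pair, so that disjoint pairs drop out and overlapping ones
   keep only their joint tail. *)
have pairE (s s' : F) : fine (P (E s `&` E s')) - q ^+ 2 <=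
    if (val s :&: val s')%SET != finset.set0 then g #|(val s :&: val s')%SET| else 0.
  case: ifPn => [_|/negPn/eqP ss0].
    rewrite lerBlDr; apply: ler_wpDr; first exact: sqr_ge0.
    rewrite -lee_fin fineK; last by apply: fin_num_measure; exact: measurableI.
    exact: qform_indv_pair_tail.
  rewrite subr_le0 -lee_fin fineK; last by apply: fin_num_measure; exact: measurableI.
  rewrite !EE (qform_indv_disjoint hW ss0)//.
  by rewrite -!EE !PE -EFinM.
have rowE (s : F) : \sum_(s' : F) (fine (P (E s `&` E s')) - q ^+ 2) <=
    2 ^+ m * 'C(p, m)%:R * b.
  apply: le_trans (sum_le_subsets (FD s) mp g0 gb).
  rewrite big_mkcondr -sumF; apply: ler_sum => s' _; exact: pairE.
have := second_moment mE PE; rewrite FE.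
have sqE : \sum_(s : F) \sum_(s' : F) q ^+ 2 = ('C(p, m)%:R * q) ^+ 2.
  have Fc : #|xpredT : pred F|%:R = 'C(p, m)%:R :> R by rewrite -FE.
  by rewrite !sumr_const -mulrnA -[LHS]mulr_natr natrM Fc; ring.
rewrite -[X in _ <= _ - X]sqE -sumrB; under [X in _ <= X]eq_bigr do rewrite -sumrB.
move=> H.
have {}H : fine (P (\bigcap_s ~` E s)) * ('C(p, m)%:R * q) ^+ 2 <=
    'C(p, m)%:R * (2 ^+ m * 'C(p, m)%:R * b).
  apply: (le_trans H); apply: (le_trans (ler_sum _ (fun s _ => rowE s))).
  by rewrite sumr_const -[leLHS]mulr_natl FE.
have q_gt0 : 0 < q by exact: lt_le_trans q0q.
have b0 : 0 <= b.
  apply: le_trans (gb 1%N _); last by rewrite m0.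
  by rewrite mulr_ge0 ?expR_ge0// exprn_ge0// divr_ge0.
have mA : measurable (\bigcap_s ~` E s).
  by apply: fin_bigcap_measurable => // s _; exact: measurableC.
have mtop := measurable_fun_top_lambda mp hW.
have mt : measurable [set w | (top_lambda m (random_mx W w) < t)%R].
  rewrite -[X in measurable X]setTI (_ : [set w | _] =
    (fun w => top_lambda m (random_mx W w)) @^-1` `]-oo, t[%classic).
    by apply: mtop => //; exact: measurable_itv.
  by apply/seteqP; split=> w /=; rewrite in_itv.
apply: (@le_trans _ _ (P (\bigcap_s ~` E s))).
  apply: le_measure; rewrite ?inE//.
  move=> w /= wt s _; rewrite /E /=; apply/negP; rewrite -ltNge.
  have := qform_le_top_lambda (random_mx_sym w hW) mp (FD s)
    (@indv_supported R p (val s)).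
  rewrite dotp_indv finset.setIid FD => /le_lt_trans; apply.
  by rewrite mulrC ltr_pM2l.
have PAf : P (\bigcap_s ~` E s) \is a fin_num by exact: fin_num_measure.
rewrite -(fineK PAf) lee_fin ler_pdivlMr ?exprn_gt0//.
apply: (@le_trans _ _ (fine (P (\bigcap_s ~` E s)) * q ^+ 2)).
  apply: ler_wpM2l; first by rewrite fine_ge0.
  rewrite ler_sqr ?nnegrE; [exact: q0q|exact: ltW|exact: ltW].
have C2 : 0 < 'C(p, m)%:R ^+ 2 :> R by rewrite exprn_gt0.
rewrite -(ler_pM2r C2).
have -> : fine (P (\bigcap_s ~` E s)) * q ^+ 2 * 'C(p, m)%:R ^+ 2 =
  fine (P (\bigcap_s ~` E s)) * ('C(p, m)%:R * q) ^+ 2 by ring.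
have -> : 2 ^+ m * b * 'C(p, m)%:R ^+ 2 = 'C(p, m)%:R * (2 ^+ m * 'C(p, m)%:R * b).
  by ring.
exact: H.
Qed.

(** * Asymptotic estimates *)

Lemma bin_le_exp (p m : nat) : ('C(p, m) <= p ^ m)%N.
Proof.
apply: (@leq_trans ('C(p, m) * m`!)%N); first by rewrite leq_pmulr// fact_gt0.
rewrite bin_ffact ffact_prod -[X in (_ <= _ ^ X)%N](card_ord m) -prod_nat_const.
by apply: leq_prod => i _; exact: leq_subr.
Qed.

(** To first order the quotient of (1 + r)^4 by the squared factor is 1 + 8 r; the constant 16
    leaves room for the higher-order terms up to r = 1/10. *)
Lemma grid_factor_le (R : realType) (r : R) : 0 <= r -> r <= 10^-1 ->
  (1 + r) ^+ 4 <= (1 + 16 * r) * (1 - 2 * r - r ^+ 2) ^+ 2.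
Proof.
move=> r0 r1; rewrite -subr_ge0.
have -> : (1 + 16 * r) * (1 - 2 * r - r ^+ 2) ^+ 2 - (1 + r) ^+ 4 =
  r * (8 - 68 * r) + 32 * r ^+ 3 + 64 * r ^+ 4 + 16 * r ^+ 5 by ring.
by rewrite !addr_ge0// mulr_ge0// ?exprn_ge0//; lra.
Qed.

Lemma ln_le_id (R : realType) (x : R) : 0 < x -> ln x <= x.
Proof.
move=> x0; have : -1 < x - 1 by lra.
by move=> /le_ln1Dx; rewrite addrC subrK; lra.
Qed.

Lemma exprn_expR (R : realType) (x y : R) (k : nat) : 0 < x -> ln x <= y ->
  x ^+ k <= expR (k%:R * y).
Proof.
move=> x0 xy; rewrite -[x in leLHS]lnK ?posrE// -expRM_natl ler_expR.
by rewrite ler_wpM2l.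
Qed.

(* With [M = sqrt (m ln p)], the parameter is [u = sqrt (sqrt M)], so that the
   hypothesis [m <= u ^+ 2] makes [m ln u] negligible with respect to [M = u ^+ 4].
   The mesh is chosen with [K] of order [u ^+ 9], the relative rounding error
   being [r = M ^- 2]. *)
Lemma wigner_upper_mgf (R : realType) (d : measure_display)
    (T : measurableType d) (P : probability T R) (m p : nat)
    (W : 'I_p -> 'I_p -> {RV P >-> R}) (u : R) :
  gaussian_wigner W -> (0 < m <= p)%N -> 2 <= u -> m%:R <= u ^+ 2 ->
  m%:R * ln p%:R = u ^+ 8 ->
  (\int[P]_w (expR (u ^+ 4 * (top_lambda m (random_mx W w) - 2 * u ^+ 4)))%:E <=
   (expR (30 * u ^+ 3))%:E)%E.
Proof.
move=> hW mp u2 mu muL; have /andP[m0 mp'] := mp.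
have u0 : 0 < u by lra.
have p0 : 0 < p%:R :> R by rewrite ltr0n (leq_trans m0).
pose r : R := (u ^+ 8)^-1.
have u8 : 256 <= u ^+ 8.
  apply: le_trans (_ : 2 ^+ 8 <= _); first by rewrite -natrX ler_nat.
  by rewrite lerXn2r ?nnegrE// ltW.
have r0 : 0 < r by rewrite invr_gt0 exprn_gt0.
have r1 : r <= 10^-1 by rewrite lef_pV2 ?posrE ?exprn_gt0//; lra.
(* The exponent 9 gives r K >= u, hence (r K)^2 >= u^2 >= m. *)
pose K := (Num.Def.trunc (u ^+ 9)).+1.
have /andP[K1 K2] : u ^+ 9 <= K%:R <= u ^+ 9 + 1.
  have /andP[] := truncn_itv (exprn_ge0 9 (ltW u0)).
  by move=> h1 h2; rewrite ltW//= /K -natr1 lerD2r.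
have rK : u <= r * K%:R.
  apply: (@le_trans _ _ (r * u ^+ 9)); last by rewrite ler_pM2l.
  by rewrite /r (exprSr u 8) mulrA mulVf ?mul1r// expf_neq0// gt_eqF.
have mK : m%:R <= (r * K%:R) ^+ 2.
  apply: (le_trans mu); rewrite ler_sqr ?nnegrE//; first exact: ltW.
  exact: le_trans (ltW u0) rK.
have k0 : 0 < 1 - 2 * r - r ^+ 2 by rewrite expr2; nra.
have b0 : 0 <= u ^+ 4 by rewrite exprn_ge0// ltW.
have H := wigner_top_lambda_mgf_le hW mp (ltn0Sn _ : (0 < K)%N) r0 mK k0 b0.
have mE : measurable_fun setT
    (fun w => (expR (u ^+ 4 * top_lambda m (random_mx W w)))%:E).
  by apply: measurable_expR_scale; exact: measurable_fun_top_lambda.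
pose c := expR (- (2 * u ^+ 8)).
have -> : (\int[P]_w (expR (u ^+ 4 * (top_lambda m (random_mx W w) - 2 * u ^+ 4)))%:E =
    c%:E * \int[P]_w (expR (u ^+ 4 * top_lambda m (random_mx W w)))%:E)%E.
  have c0 : (0 <= c%:E :> \bar R)%E by rewrite lee_fin expR_ge0.
  have E0 w : (0 <= (expR (u ^+ 4 * top_lambda m (random_mx W w)))%:E :> \bar R)%E.
    by rewrite lee_fin expR_ge0.
  rewrite -ge0_integralZl//.
  apply: eq_integral => w _; rewrite -EFinM /c -expRD; congr ((expR _)%:E); ring.
apply: (le_trans (lee_wpmul2l _ H)); first by rewrite lee_fin expR_ge0.
rewrite -EFinM lee_fin natrM.
have C_le : 'C(p, m)%:R <= expR (u ^+ 8) :> R.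
  rewrite -muL expRM_natl lnK ?posrE// -natrX ler_nat.
  exact: bin_le_exp.
have u9 : 1 <= u ^+ 9 by rewrite exprn_ege1//; lra.
have N_le : (K.*2.+1 ^ m)%:R <= expR (u ^+ 2 * (4 + 9 * u)) :> R.
  have NE : (K.*2.+1)%:R = 2 * K%:R + 1 :> R by rewrite -natr1 -muln2 natrM mulrC.
  have N5 : (K.*2.+1)%:R <= 5 * u ^+ 9 :> R by rewrite NE; lra.
  have lnN : ln (K.*2.+1)%:R <= 4 + 9 * u :> R.
    apply: (@le_trans _ _ (ln (5 * u ^+ 9))).
      by rewrite ler_ln ?posrE// mulr_gt0// exprn_gt0.
    rewrite lnM ?posrE ?exprn_gt0// lnXn// -(mulr_natl (ln u) 9); apply: lerD.
      have : -1 < 4 :> R by lra.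
      by move=> /le_ln1Dx; rewrite (_ : 1 + 4 = 5 :> R)//; lra.
    by rewrite ler_wpM2l// ln_le_id.
  rewrite natrX; apply: (le_trans (exprn_expR _ _ lnN)) => //.
  by rewrite ler_expR ler_wpM2r//; lra.
have e2 : 2 <= expR 1 :> R by have := expR_ge1Dx (1 : R); lra.
have r8 : r * u ^+ 8 = 1 by rewrite /r mulVf// expf_neq0// gt_eqF.
have q_le : (u ^+ 4 / (1 - 2 * r - r ^+ 2)) ^+ 2 * (1 + r) ^+ 4 <= u ^+ 8 + 16.
  have k2 : 0 < (1 - 2 * r - r ^+ 2) ^+ 2 by rewrite exprn_gt0.
  rewrite expr_div_n mulrAC ler_pdivrMr// (_ : (u ^+ 4) ^+ 2 = u ^+ 8);
    last by rewrite -exprM.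
  have -> : u ^+ 8 + 16 = u ^+ 8 * (1 + 16 * r)
    by rewrite mulrDr mulr1 mulrCA (mulrC _ r) r8 mulr1.
  rewrite -(mulrA (u ^+ 8)); apply: ler_wpM2l; first by rewrite exprn_ge0// ltW.
  exact: grid_factor_le (ltW r0) r1.
(* The left side is the total exponent: 1 for the factor 2, u^8 for the choice of the set, 4 u^2 + 9
   u^3 for the grid and u^8 + 16 for the Gaussian moment, minus 2 u^8 from centring. *)
have u3 : 17 + 4 * u ^+ 2 + 9 * u ^+ 3 <= 30 * u ^+ 3.
  have : 2 * 2 <= u ^+ 2 by rewrite expr2 ler_pM//; lra.
  have : 2 * u ^+ 2 <= u ^+ 3 by rewrite exprS ler_wpM2r ?sqr_ge0.
  lra.
apply: (@le_trans _ _ (c * (expR 1 * (expR (u ^+ 8) * expR (u ^+ 2 * (4 + 9 * u))) *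
    expR (u ^+ 8 + 16)))).
  rewrite ler_wpM2l ?expR_ge0//; apply: ler_pM; rewrite ?mulr_ge0 ?expR_ge0//; last first.
    by rewrite ler_expR.
  by apply: ler_pM => //; apply: ler_pM.
rewrite /c -!expRD ler_expR; apply: le_trans u3.
rewrite le_eqVlt; apply/orP; left; apply/eqP; ring.
Qed.

(* [x = k / m] is the relative overlap and [t = 2 M - s] the threshold.  At
   [s = 0] the left-hand side is [- M ^+ 2 * x * (1 - x) ^+ 2 / (1 + x ^+ 2)],
   which degenerates at [x = 1]: there the shift by [s] is needed. *)
Lemma overlap_exponent_le (R : realType) (M s x : R) :
  0 < s -> s <= M -> 0 <= x -> x <= 1 -> s <= M * x ->
  (2 * M - s) ^+ 2 / 2 * (x ^+ 2 / (1 + x ^+ 2)) - x * M ^+ 2 <= - (M * s / 5).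
Proof.
move=> s0 sM x0 x1 sMx.
have M0 : 0 < M by lra.
have x2 : 0 < 1 + x ^+ 2 by rewrite ltr_pwDl// sqr_ge0.
pose y := x ^+ 2 / (1 + x ^+ 2); rewrite -/y.
have y0 : 0 <= y by rewrite divr_ge0 ?sqr_ge0// ltW.
have yE : y * (1 + x ^+ 2) = x ^+ 2 by rewrite /y mulfVK// gt_eqF.
have tM : (2 * M - s) ^+ 2 / 2 <= 2 * M ^+ 2 - M * s by nra.
apply: (@le_trans _ _ ((2 * M ^+ 2 - M * s) * y - x * M ^+ 2)).
  by rewrite lerD2r ler_wpM2r.
(* For x >= 1/2 the terms in M^2 may cancel, as 2 y <= x is sharp at x = 1; the gain is M s y with y
   >= 1/5. For x < 1/2 the stronger 2 y <= 4 x / 5 leaves - M^2 x / 5, and s <= M x concludes. *)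
have [xh|xh] := leP (2^-1) x.
  have x4 : 4^-1 <= x ^+ 2.
    have : 2^-1 * 2^-1 <= x * x by apply: ler_pM => //; lra.
    by rewrite expr2; lra.
  have y5 : 5^-1 <= y by rewrite /y ler_pdivlMr//; lra.
  have yx : 2 * y <= x.
    rewrite /y mulrA ler_pdivrMr//.
    by have := mulr_ge0 x0 (sqr_ge0 (1 - x)); lra.
  have h1 : M ^+ 2 * (2 * y) <= M ^+ 2 * x by rewrite ler_wpM2l ?sqr_ge0.
  have h2 : M * s * 5^-1 <= M * s * y by rewrite ler_wpM2l// mulr_ge0// ltW.
  lra.
have yx : 2 * y <= 4 / 5 * x.
  rewrite /y mulrA ler_pdivrMr//.
  have h : 0 <= x * ((1 - 2 * x) * (4 - 2 * x)).
    by apply: mulr_ge0 => //; apply: mulr_ge0; lra.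
  lra.
have h1 : M ^+ 2 * (2 * y) <= M ^+ 2 * (4 / 5 * x) by rewrite ler_wpM2l ?sqr_ge0.
have h2 : M * s <= M * (M * x) by rewrite ler_wpM2l// ltW.
have h3 : 0 <= M * s * y by apply: mulr_ge0 => //; apply: mulr_ge0; exact: ltW.
rewrite expr2 in h1 *; lra.
Qed.

(** The term - (t + e)^2 / 2 is kept apart because it cancels against the square of the one-set
    probability. The rest is the gain M s / 5, less M s / 20 for the window, and the entropy k ln m,
    at most 2 u^3. *)
Lemma overlap_term_le (R : realType) (m p k : nat) (u s t e : R) :
  (0 < m <= p)%N -> (0 < k <= m)%N -> m%:R * ln p%:R = u ^+ 8 ->
  m%:R <= u ^+ 2 -> 1 <= u -> 0 < s -> s <= u -> e = s / 40 ->
  t = 2 * u ^+ 4 - s ->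
  expR (- (m%:R ^+ 2 * t ^+ 2 / (2 * (m%:R ^+ 2 + k%:R ^+ 2)))) *
    (m%:R / p%:R) ^+ k <=
  expR (- (3 * u ^+ 4 * s / 20) + u ^+ 2 * (2 * u) - (t + e) ^+ 2 / 2).
Proof.
move=> /andP[m0 mp] /andP[k0 km] muL mu u1 s0 su eE tE.
have u0 : 0 < u by lra.
have mR : 0 < m%:R :> R by rewrite ltr0n.
have pR : 0 < p%:R :> R by rewrite ltr0n (leq_trans m0).
have kR : 0 < k%:R :> R by rewrite ltr0n.
have kmR : k%:R <= m%:R :> R by rewrite ler_nat.
have k1 : 1 <= k%:R :> R by rewrite ler1n.
pose x : R := k%:R / m%:R.
pose M := u ^+ 4.
have M2 : M ^+ 2 = u ^+ 8 by rewrite /M -exprM.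
have uu : 1 <= u ^+ 2 by rewrite exprn_ege1.
have MM : M = u ^+ 2 * u ^+ 2 by rewrite /M -exprD.
have u_le_u2 : u <= u ^+ 2 by rewrite expr2; apply: ler_peMr => //; exact: ltW.
have uu0 : 0 <= u ^+ 2 by exact: sqr_ge0.
have su2 : s <= u ^+ 2 by exact: le_trans su u_le_u2.
have sM : s <= M by rewrite MM; apply: (le_trans su2); exact: ler_peMr.
have x0 : 0 <= x by rewrite divr_ge0// ltW.
have x1 : x <= 1 by rewrite ler_pdivrMr// mul1r.
(* Nonzero overlap means x >= 1/m, and s <= u^2 together with m <= u^2 gives s m <= M. *)
have sMx : s <= M * x.
  rewrite /x mulrA ler_pdivlMr//; apply: (@le_trans _ _ M).
    by rewrite MM; apply: ler_pM => //; exact: ltW.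
  by apply: ler_peMr => //; rewrite MM mulr_ge0.
have key := overlap_exponent_le s0 sM x0 x1 sMx.
have -> : (m%:R / p%:R) ^+ k = expR (k%:R * (ln m%:R - ln p%:R)) :> R.
  by rewrite expRM_natl expRB !lnK ?posrE.
rewrite -expRD ler_expR.
have lnm : k%:R * ln m%:R <= u ^+ 2 * (2 * u) :> R.
  have ln0 : 0 <= ln m%:R :> R by rewrite ln_ge0// ler1n.
  apply: ler_pM => //; first exact: le_trans kmR mu.
  apply: (@le_trans _ _ (ln (u ^+ 2))); first by rewrite ler_ln ?posrE// exprn_gt0.
  by rewrite lnXn// -(mulr_natl (ln u) 2) ler_wpM2l// ln_le_id.
have kL : k%:R * ln p%:R = x * M ^+ 2 :> R.
  by rewrite M2 -muL /x mulrA divfK// gt_eqF.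
have fracE : m%:R ^+ 2 * t ^+ 2 / (2 * (m%:R ^+ 2 + k%:R ^+ 2)) =
    t ^+ 2 / 2 - t ^+ 2 / 2 * (x ^+ 2 / (1 + x ^+ 2)) :> R.
  rewrite /x; field.
  rewrite !gt_eqF//; apply: addr_gt0; exact: exprn_gt0.
(* The increment is at most 2 M e; this is where e = s / 40 comes from. *)
have te : (t + e) ^+ 2 / 2 - t ^+ 2 / 2 <= M * s / 20.
  by rewrite tE -/M eE; nra.
move: lnm key te; rewrite fracE mulrBr kL tE -/M.
move: (k%:R * ln m%:R) ((2 * M - s) ^+ 2 / 2 * _) => a1 a2.
move: ((2 * M - s + e) ^+ 2 / 2) ((2 * M - s) ^+ 2 / 2) (x * M ^+ 2) => a3 a4 a5.
lra.
Qed.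

(** The threshold depends on [s] alone, uniformly in the probability space, [m] and [p]; this lets
    it be fixed before the limit is taken. *)
Lemma wigner_lower_tail_exp (R : realType) (s : R) : 0 < s ->
  exists u0 : R, forall u, u0 <= u ->
  forall (d : measure_display) (T : measurableType d) (P : probability T R)
    (m p : nat) (W : 'I_p -> 'I_p -> {RV P >-> R}),
  gaussian_wigner W -> (0 < m <= p)%N -> m%:R <= u ^+ 2 ->
  m%:R * ln p%:R = u ^+ 8 ->
  (P [set w | (top_lambda m (random_mx W w) < 2 * u ^+ 4 - s)%R] <=
   (expR (- (u ^+ 4 * s / 10)))%:E)%E.
Proof.
move=> s0; pose e : R := s / 40.
have e0 : 0 < e by rewrite divr_gt0.
have sq2 : Num.sqrt 2 != 0 :> R by rewrite gt_eqF// sqrtr_gt0.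
pose a : R := e * normal_peak (Num.sqrt 2).
have a0 : 0 < a by rewrite mulr_gt0// normal_peak_gt0.
pose c : R := (a ^+ 2)^-1.
have c0 : 0 <= c by rewrite invr_ge0 sqr_ge0.
have cs0 : 0 <= 20 * (3 + c) / s.
  by apply: divr_ge0; [apply: mulr_ge0 => //; apply: addr_ge0|exact: ltW].
(* The decay 3 M s / 20 must absorb u^2 from 2^m, 2 u^3 from the overlaps and [c] from the constant
   prefactor. Their sum is at most (3 + c) u^3, and the last summand makes this at most M s / 20. *)
exists (1 + s + 20 * (3 + c) / s) => u u0 d T P m p W hW mp mu muL.
have u1 : 1 <= u by lra.
have su : s <= u by lra.
have cu : (3 + c) * 20 <= u * s by rewrite -ler_pdivrMr// mulrC; lra.
have u_gt0 : 0 < u by lra.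
pose t := 2 * u ^+ 4 - s.
have uu1 : 1 <= u ^+ 2 by rewrite exprn_ege1.
have uu3 : u ^+ 2 <= u ^+ 3 by apply: ler_weXn2l.
have u41 : u <= u ^+ 4 by rewrite -[leLHS]expr1; apply: ler_weXn2l.
have t0 : 0 <= t by rewrite /t; lra.
have gb (k : nat) (hk : (0 < k <= m)%N) :=
  overlap_term_le mp hk muL mu u1 s0 su (erefl e) (erefl t).
have H := wigner_lower_tail hW mp t0 e0 (erefl _) gb.
apply: (le_trans H); rewrite lee_fin -/a.
have E2 : 2 ^+ m <= expR (u ^+ 2) :> R.
  have l2 : ln 2 <= 1 :> R.
    have : -1 < 1 :> R by lra.
    by move=> /le_ln1Dx; rewrite (_ : 1 + 1 = 2 :> R).
  by apply: (le_trans (exprn_expR _ _ l2)) => //; rewrite mulr1 ler_expR.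
have qE : (a * expR (- ((t + e) ^+ 2 / 4))) ^+ 2 =
    a ^+ 2 * expR (- ((t + e) ^+ 2 / 2)).
  by rewrite exprMn -expRM_natl; congr (_ * expR _); field.
rewrite qE.
have -> : expR (- (3 * u ^+ 4 * s / 20) + u ^+ 2 * (2 * u) - (t + e) ^+ 2 / 2) =
   expR (- (3 * u ^+ 4 * s / 20) + u ^+ 2 * (2 * u)) * expR (- ((t + e) ^+ 2 / 2)).
  by rewrite -expRD.
have Eg : expR (- ((t + e) ^+ 2 / 2)) != 0 by rewrite gt_eqF// expR_gt0.
have -> : 2 ^+ m * (expR (- (3 * u ^+ 4 * s / 20) + u ^+ 2 * (2 * u)) *
    expR (- ((t + e) ^+ 2 / 2))) / (a ^+ 2 * expR (- ((t + e) ^+ 2 / 2))) =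
    2 ^+ m * expR (- (3 * u ^+ 4 * s / 20) + u ^+ 2 * (2 * u)) * c.
  by rewrite /c; field; rewrite Eg gt_eqF.
have Ec : c <= expR c by apply: le_trans (expR_ge1Dx c); lra.
apply: (@le_trans _ _ (expR (u ^+ 2) *
  expR (- (3 * u ^+ 4 * s / 20) + u ^+ 2 * (2 * u)) * expR c)).
  apply: ler_pM => //; last by apply: ler_wpM2r => //; exact: expR_ge0.
rewrite -!expRD ler_expR.
have u3 : u ^+ 2 * (2 * u) = 2 * u ^+ 3 by ring.
have u31 : 1 <= u ^+ 3 by rewrite exprn_ege1.
have h1 : (3 + c) * 20 * u ^+ 3 <= u ^+ 4 * s.
  have -> : u ^+ 4 * s = u * s * u ^+ 3 by ring.
  by apply: ler_wpM2r => //; lra.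
have h2 : c <= c * u ^+ 3 by apply: ler_peMr.
rewrite u3; have -> : 3 * u ^+ 4 * s = 3 * (u ^+ 4 * s) by ring.
move: h1 h2; have -> : (3 + c) * 20 * u ^+ 3 = 60 * u ^+ 3 + 20 * (c * u ^+ 3) by ring.
move: uu3; move: (u ^+ 4 * s) (c * u ^+ 3) (u ^+ 3) (u ^+ 2) => y1 y2 y3 y4; lra.
Qed.

(** * Exponential moments of the deviation *)

(* [X] is a Gaussian minorant of [T]: it controls the region where [T] is so small
   that only the trivial bound [2 M - X] for the deviation is available. *)
Lemma deviation_pointwise (R : realType) (alpha delta M T X : R) :
  0 < alpha -> 0 < delta -> alpha <= M -> X <= T ->
  expR (alpha * `|2 * M - T|) * (delta <= `|2 * M - T|)%R%:R <=
  expR (M * (T - 2 * M)) * expR (- ((M - alpha) * delta)) +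
  expR (80 * alpha ^+ 2) * (T < 2 * M - delta / 2)%R%:R +
  expR (7 * alpha * M) * (T < 2 * M - 80 * alpha)%R%:R +
  expR (- (3 * alpha * M)) * expR (- (2 * alpha) * X).
Proof.
move=> a0 d0 aM XT; set Y := 2 * M - T.
have e (x : R) : 0 <= expR x by exact: expR_ge0.
set F1 := expR (M * _) * expR _; set F2 := expR (80 * _) * _.
set F3 := expR (7 * _ * _) * _; set F4 := expR (- _) * expR _.
have f1 : 0 <= F1 by exact: mulr_ge0.
have f2 : 0 <= F2 by exact: mulr_ge0.
have f3 : 0 <= F3 by exact: mulr_ge0.
have f4 : 0 <= F4 by exact: mulr_ge0.
case: (leP delta `|Y|) => dY /=; last by rewrite mulr0; lra.
(* When T exceeds 2 M by at least delta, replacing the slope alpha by M gains the factor e^(- (M -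
   alpha) delta). *)
rewrite mulr1; have [Y0|Y0] := leP 0 Y; last first.
  suff : expR (alpha * `|Y|) <= F1 by lra.
  rewrite /F1 -expRD ler_expR; move: dY; rewrite (ltr0_norm Y0) => dY.
  have : 0 <= (M - alpha) * (- Y - delta) by apply: mulr_ge0; lra.
  by rewrite /Y; nra.
rewrite (ger0_norm Y0) in dY *.
(* The level 80 alpha has lower-tail exponent 8 alpha M, which beats the bound e^(7 alpha M) used
   beyond it. Below it, halving delta turns the weak inequality on Y into the strict one of the tail
   event. *)
have [YK|YK] := leP Y (80 * alpha).
  suff : expR (alpha * Y) <= F2 by lra.
  have -> : F2 = expR (80 * alpha ^+ 2).
    have h : T < 2 * M - delta / 2 by rewrite /Y in dY; lra.
    by rewrite /F2 h /= mulr1.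
  by rewrite ler_expR; nra.
suff : expR (alpha * Y) <= F3 + F4 by lra.
have -> : F3 = expR (7 * alpha * M).
  have h : T < 2 * M - 80 * alpha by rewrite /Y in YK; lra.
  by rewrite /F3 h /= mulr1.
have Yle : alpha * Y <= 2 * alpha * M - alpha * X by rewrite /Y; nra.
(* If X >= - 5 M then Y <= 7 M. Otherwise alpha X <= - 5 alpha M trades 2 alpha M - alpha X for - 3
   alpha M - 2 alpha X, whose exponential has small mean. *)
have [hX|hX] := leP (- (5 * M)) X.
  suff : expR (alpha * Y) <= expR (7 * alpha * M) by lra.
  by rewrite ler_expR; nra.
suff : expR (alpha * Y) <= F4 by have := e (7 * alpha * M); lra.
by rewrite /F4 -expRD ler_expR; nra.
Qed.

Lemma expRN_le_inv (R : realType) (u x : R) : 0 < u -> x <= - u -> expR x <= u^-1.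
Proof.
move=> u0 xu; apply: (@le_trans _ _ (expR (- u))); first by rewrite ler_expR.
rewrite expRN lef_pV2 ?posrE ?expR_gt0//.
by apply: le_trans (expR_ge1Dx u); lra.
Qed.

(** The four left sides are, in order, the logarithms of the bounds for the expectations of the four
    terms in [deviation_pointwise]. The common target - u makes each expectation at most 1/u. *)
Lemma deviation_exponents (R : realType) (alpha delta u : R) :
  0 < alpha -> 0 < delta -> 1 <= u -> (31 + alpha * delta) / delta <= u ->
  (80 * alpha ^+ 2 + 1) * 20 / delta <= u -> alpha^-1 <= u -> 2 * alpha <= u ->
  [/\ 30 * u ^+ 3 - (u ^+ 4 - alpha) * delta <= - u,
    80 * alpha ^+ 2 - u ^+ 4 * (delta / 2) / 10 <= - u,
    7 * alpha * u ^+ 4 - u ^+ 4 * (80 * alpha) / 10 <= - u &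
    - (3 * alpha * u ^+ 4) + 4 * alpha ^+ 2 <= - u].
Proof.
move=> a0 d0 u1; rewrite ler_pdivrMr// => h1; rewrite ler_pdivrMr// => h2 h3 h4.
have {}h3 : 1 <= alpha * u by rewrite -ler_pdivrMl// mulr1.
have u3 : 1 <= u ^+ 3 by rewrite exprn_ege1.
have u3u : u <= u ^+ 3 by rewrite -[leLHS]expr1; apply: ler_weXn2l.
have u4 : u ^+ 4 = u * u ^+ 3 by rewrite exprS.
have ad : 0 <= alpha * delta by rewrite mulr_ge0 ?ltW.
split.
- have k1 : (31 + alpha * delta) * u ^+ 3 <= u * delta * u ^+ 3.
    by apply: ler_wpM2r => //; lra.
  have k2 : alpha * delta <= alpha * delta * u ^+ 3 by exact: ler_peMr.
  rewrite u4; lra.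
- have k1 : (80 * alpha ^+ 2 + 1) * 20 * u ^+ 3 <= u * delta * u ^+ 3.
    by apply: ler_wpM2r => //; lra.
  have k2 : 80 * alpha ^+ 2 <= 80 * alpha ^+ 2 * u ^+ 3.
    by apply: ler_peMr => //; rewrite mulr_ge0// sqr_ge0.
  rewrite u4; lra.
- have k1 : 1 * u ^+ 3 <= alpha * u * u ^+ 3 by apply: ler_wpM2r => //; lra.
  rewrite u4; lra.
- have k1 : 1 * u ^+ 3 <= alpha * u * u ^+ 3 by apply: ler_wpM2r => //; lra.
  have k2 : alpha * (2 * alpha) <= alpha * u ^+ 4.
    apply: ler_wpM2l; first exact: ltW.
    rewrite u4; apply: (le_trans h4); apply: ler_peMr => //; lra.
  rewrite u4 in k2 *; rewrite expr2; lra.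
Qed.

(** The Rayleigh quotient of the indicator of one fixed set, with law N(0, 2) for all [m] and
    [p]. *)
Lemma wigner_gaussian_minorant (R : realType) (d : measure_display)
    (T : measurableType d) (P : probability T R) (m p : nat)
    (W : 'I_p -> 'I_p -> {RV P >-> R}) (c : R) :
  gaussian_wigner W -> (0 < m <= p)%N ->
  exists X : T -> R, [/\ measurable_fun setT X,
    forall w, X w <= top_lambda m (random_mx W w) &
    (\int[P]_w (expR (c * X w))%:E = (expR (c ^+ 2))%:E)%E].
Proof.
move=> hW mp; have /andP[m0 mp'] := mp.
have mR : 0 < m%:R :> R by rewrite ltr0n.
have [S Sm] : exists S : {set 'I_p}, #|S| = m.
  have : (0 < #|[set S : {set 'I_p} | #|S| == m]%SET|)%N.
    by rewrite card_draws card_ord bin_gt0.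
  by move=> /card_gt0P[S]; rewrite inE => /eqP Sm; exists S.
exists (fun w => m%:R^-1 * qform (random_mx W w) (indv R S)); split.
- apply: measurable_funM; first exact: measurable_cst.
  exact: measurable_qform_random_mx.
- move=> w; have := qform_le_top_lambda (random_mx_sym w hW) mp Sm
    (@indv_supported R p S).
  by rewrite dotp_indv finset.setIid Sm ler_pdivrMl// mulrC.
- under eq_integral do rewrite mulrA.
  rewrite (wigner_qform_mgf _ _ hW) dotp_indv finset.setIid Sm.
  by congr ((expR _)%:E); field; rewrite gt_eqF.
Qed.

Lemma measurable_lt_set (R : realType) (d : measure_display)
    (T : measurableType d) (f : T -> R) (c : R) :
  measurable_fun setT f -> measurable [set w | f w < c].
Proof.
move=> mf; rewrite -[X in measurable X]setTI
  (_ : [set w | _] = f @^-1` `]-oo, c[%classic).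
  by apply: mf => //; exact: measurable_itv.
by apply/seteqP; split=> w /=; rewrite in_itv.
Qed.

Lemma integral_scale_indic (R : realType) (d : measure_display)
    (T : measurableType d) (P : probability T R) (c : R) (A : set T) :
  0 <= c -> measurable A ->
  (\int[P]_w (c * \1_A w)%:E = c%:E * P A)%E.
Proof.
move=> c0 mA; under eq_integral do rewrite EFinM.
rewrite ge0_integralZl//; last exact/measurable_EFinP/measurable_indic.
by rewrite integral_indic// setIT.
Qed.

Lemma indic_pred (R : realType) (T : Type) (b : T -> bool) (w : T) :
  \1_[set w | b w] w = (b w)%:R :> R.
Proof.
rewrite indicE; congr (_%:R); congr nat_of_bool.
by apply/idP/idP; rewrite inE.
Qed.

Lemma wigner_deviation_bound (R : realType) (alpha delta : R) :
  0 < alpha -> 0 < delta ->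
  exists u0 : R, forall u, u0 <= u ->
  forall (d : measure_display) (T : measurableType d) (P : probability T R)
    (m p : nat) (W : 'I_p -> 'I_p -> {RV P >-> R}),
  gaussian_wigner W -> (0 < m <= p)%N -> m%:R <= u ^+ 2 ->
  m%:R * ln p%:R = u ^+ 8 ->
  (\int[P]_w (expR (alpha * `|2 * u ^+ 4 - top_lambda m (random_mx W w)|) *
      \1_[set w | delta <= `|2 * u ^+ 4 - top_lambda m (random_mx W w)|] w)%:E <=
   (4 / u)%:E)%E.
Proof.
move=> a0 d0.
(* The lower tail is needed at two depths: delta / 2 for bounded deviations and 80 alpha for large
   ones. *)
have [u1 U1] := wigner_lower_tail_exp (divr_gt0 d0 (ltr0n R 2)).
have [u2 U2] := wigner_lower_tail_exp (mulr_gt0 (ltr0n R 80) a0).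
pose h1 := (31 + alpha * delta) / delta.
pose h2 := (80 * alpha ^+ 2 + 1) * 20 / delta.
have h1_ge0 : 0 <= h1.
  by apply: divr_ge0; [apply: addr_ge0 => //; apply: mulr_ge0|]; exact: ltW.
have h2_ge0 : 0 <= h2.
  apply: divr_ge0; last exact: ltW.
  by apply: mulr_ge0 => //; apply: addr_ge0 => //; apply: mulr_ge0 => //; exact: sqr_ge0.
have ai : 0 <= alpha^-1 by rewrite invr_ge0 ltW.
exists (2 + `|u1| + `|u2| + h1 + h2 + alpha^-1 + 2 * alpha) => u uu.
move=> d T P m p W hW mp mu muL.
have n1 := normr_ge0 u1; have n2 := normr_ge0 u2.
have l1 := ler_norm u1; have l2 := ler_norm u2.
have u_ge1 : 1 <= u by lra.
have u_ge2 : 2 <= u by lra.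
have u_gt0 : 0 < u by lra.
have uu1 : u1 <= u by lra.
have uu2 : u2 <= u by lra.
have uh1 : h1 <= u by lra.
have uh2 : h2 <= u by lra.
have uai : alpha^-1 <= u by lra.
have u2a : 2 * alpha <= u by lra.
have [e1 e2 e3 e4] := deviation_exponents a0 d0 u_ge1 uh1 uh2 uai u2a.
have {}U1 := U1 u uu1 d T P m p W hW mp mu muL.
have {}U2 := U2 u uu2 d T P m p W hW mp mu muL.
have U3 := wigner_upper_mgf hW mp u_ge2 mu muL.
have [X [mX XT EX]] := wigner_gaussian_minorant (- (2 * alpha)) hW mp.
pose t w := top_lambda m (random_mx W w).
have mt : measurable_fun setT t by exact: measurable_fun_top_lambda.
pose M := u ^+ 4.
have aM : alpha <= M.
  have : u <= u ^+ 4 by rewrite -[leLHS]expr1; apply: ler_weXn2l.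
  by rewrite -/M; lra.
pose A2 := [set w | t w < 2 * M - delta / 2].
pose A3 := [set w | t w < 2 * M - 80 * alpha].
have mA2 : measurable A2 by exact: measurable_lt_set.
have mA3 : measurable A3 by exact: measurable_lt_set.
pose F1 w : \bar R :=
  ((expR (- ((M - alpha) * delta)))%:E * (expR (M * (t w - 2 * M)))%:E)%E.
pose F2 w : \bar R := (expR (80 * alpha ^+ 2) * \1_A2 w)%:E.
pose F3 w : \bar R := (expR (7 * alpha * M) * \1_A3 w)%:E.
pose F4 w : \bar R := ((expR (- (3 * alpha * M)))%:E * (expR (- (2 * alpha) * X w))%:E)%E.
have f1 w : (0 <= F1 w)%E by rewrite mule_ge0// lee_fin expR_ge0.
have f2 w : (0 <= F2 w)%E by rewrite lee_fin mulr_ge0// expR_ge0.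
have f3 w : (0 <= F3 w)%E by rewrite lee_fin mulr_ge0// expR_ge0.
have f4 w : (0 <= F4 w)%E by rewrite mule_ge0// lee_fin expR_ge0.
have mt2 : measurable_fun setT (fun w => t w - 2 * M).
  by apply: measurable_funB => //; exact: measurable_cst.
have mG1 := measurable_expR_scale M mt2.
have mG4 := measurable_expR_scale (- (2 * alpha)) mX.
have mF1 : measurable_fun setT F1 by apply: emeasurable_funM => //; exact: measurable_cst.
have mF2 : measurable_fun setT F2.
  by apply/measurable_EFinP; apply: measurable_funM => //; exact: measurable_indic.
have mF3 : measurable_fun setT F3.
  by apply/measurable_EFinP; apply: measurable_funM => //; exact: measurable_indic.
have mF4 : measurable_fun setT F4 by apply: emeasurable_funM => //; exact: measurable_cst.
apply: (@le_trans _ _ (\int[P]_w (F1 w + F2 w + F3 w + F4 w))%E).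
  apply: ge0_le_integral => //.
  - have mY : measurable_fun setT (fun w => `|2 * M - t w|).
      apply: measurableT_comp => //.
      by apply: measurable_funB => //; exact: measurable_cst.
    apply/measurable_EFinP; apply: measurable_funM.
      exact/measurable_EFinP/measurable_expR_scale.
    apply: measurable_indic; rewrite -[X in measurable X]setTI
      (_ : [set w | _] = (fun w => `|2 * M - t w|) @^-1` `[delta, +oo[%classic).
      by apply: mY => //; exact: measurable_itv.
    by apply/seteqP; split=> w /=; rewrite in_itv/= andbT.
  - by do 3! apply: emeasurable_funD => //.
  - move=> w _; rewrite /F1 /F2 /F3 /F4 -!EFinM -!EFinD lee_fin.
    rewrite /A2 /A3 !indic_pred [X in _ <= X + _ + _ + _]mulrC.
    exact: deviation_pointwise.
have P2 : (\int[P]_w F2 w <= (u^-1)%:E)%E.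
  rewrite integral_scale_indic ?expR_ge0//.
  apply: (le_trans (lee_wpmul2l _ U1)); first by rewrite lee_fin expR_ge0.
  by rewrite -EFinM -expRD lee_fin expRN_le_inv.
have P3 : (\int[P]_w F3 w <= (u^-1)%:E)%E.
  rewrite integral_scale_indic ?expR_ge0//.
  apply: (le_trans (lee_wpmul2l _ U2)); first by rewrite lee_fin expR_ge0.
  by rewrite -EFinM -expRD lee_fin expRN_le_inv.
have P1 : (\int[P]_w F1 w <= (u^-1)%:E)%E.
  rewrite ge0_integralZl// ?lee_fin ?expR_ge0//.
  apply: (le_trans (lee_wpmul2l _ U3)); first by rewrite lee_fin expR_ge0.
  by rewrite -EFinM -expRD lee_fin expRN_le_inv// addrC.
have P4 : (\int[P]_w F4 w <= (u^-1)%:E)%E.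
  rewrite ge0_integralZl// ?lee_fin ?expR_ge0// EX -EFinM -expRD lee_fin.
  rewrite expRN_le_inv//; apply: le_trans e4.
  by rewrite sqrrN exprMn -natrX.
have f12 w : (0 <= F1 w + F2 w)%E by exact: adde_ge0.
have f123 w : (0 <= F1 w + F2 w + F3 w)%E by exact: adde_ge0.
have m12 : measurable_fun setT (fun w => F1 w + F2 w)%E by exact: emeasurable_funD.
have m123 : measurable_fun setT (fun w => F1 w + F2 w + F3 w)%E by exact: emeasurable_funD.
rewrite ge0_integralD// ge0_integralD// ge0_integralD//.
have -> : (4 / u)%:E = ((u^-1)%:E + (u^-1)%:E + (u^-1)%:E + (u^-1)%:E)%E.
  by rewrite -!EFinD; congr EFin; ring.
exact: (leeD (leeD (leeD P1 P2) P3) P4).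
Qed.

(** * Passage to the limit along the sequence of dimensions *)

Lemma cvge0_of_near_le (R : realType) (f : nat -> \bar R) :
  (forall n, 0 <= f n)%E ->
  (forall e : R, 0 < e -> \forall n \near \oo, (f n <= e%:E)%E) ->
  f n @[n --> \oo] --> 0%E.
Proof.
move=> f0 fe; apply/fine_cvgP; split.
  near=> n; rewrite ge0_fin_numE//; apply: le_lt_trans (ltry 1).
  near: n; exact: fe.
apply/cvgrPdist_le => e e0; near=> n.
have fne : (f n <= e%:E)%E by near: n; exact: fe.
rewrite sub0r normrN /= ger0_norm ?fine_ge0// -lee_fin fineK//.
rewrite ge0_fin_numE//; exact: le_lt_trans fne (ltry _).
Unshelve. all: by end_near. Qed.

Lemma near_ln_ge (R : realType) (p : nat -> nat) (A : R) :
  p @ \oo --> \oo -> \forall n \near \oo, A <= ln (p n)%:R.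
Proof.
move=> p_infty.
pose N := (Num.Def.trunc (expR A)).+1.
have H : \forall n \near \oo, (N <= p n)%N := p_infty _ (nbhs_infty_ge N).
near=> n; have pn : (N <= p n)%N by near: n; exact: H.
have pA : expR A <= (p n)%:R.
  have /andP[_ h] := truncn_itv (expR_ge0 A).
  by apply: (le_trans (ltW h)); rewrite ler_nat.
rewrite -(expRK A) ler_ln ?posrE ?expR_gt0//.
exact: lt_le_trans (expR_gt0 A) pA.
Unshelve. all: by end_near. Qed.

Lemma assumption2_cube_le (R : realType) (p m : nat -> nat) :
  p @ \oo --> \oo -> assumption2 R p m ->
  \forall n \near \oo, (m (p n))%:R ^+ 3 <= ln (p n)%:R :> R.
Proof.
move=> p_infty [[k _ mk]|[_ mo]].
  by near=> n; rewrite mk; near: n; exact: near_ln_ge.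
have {}mo := (eqoP _ _ _).1 mo 1 ltr01.
near=> n.
(* Once L >= e the denominator ln L is at least 1, so the little-o with constant 1 yields m <=
   L^(1/3). *)
have L1 : expR 1 <= ln (p n)%:R :> R by near: n; exact: near_ln_ge.
have H : `|(m (p n))%:R : R| <=
    1 * `|ln (p n)%:R `^ (3%:R)^-1 / ln (ln (p n)%:R)| by near: n; exact: mo.
set L := ln (p n)%:R in L1 H *.
have L0 : 0 < L by exact: lt_le_trans (expR_gt0 1) L1.
have lnL : 1 <= ln L by rewrite -(expRK 1) ler_ln ?posrE ?expR_gt0.
have mL : (m (p n))%:R <= L `^ (3%:R)^-1.
  rewrite mul1r ger0_norm// in H; apply: (le_trans H).
  rewrite ger0_norm ?divr_ge0 ?powR_ge0//; last exact: le_trans ler01 lnL.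
  rewrite ler_pdivrMr ?(lt_le_trans ltr01 lnL)//.
  by rewrite ler_peMr// powR_ge0.
have -> : L = (L `^ (3%:R)^-1) ^+ 3.
  by rewrite -powR_mulrn ?powR_ge0// -powRrM mulVf// powRr1// ltW.
by rewrite lerXn2r ?nnegrE// powR_ge0.
Unshelve. all: by end_near. Qed.

(** The parameter u at x = m ln p; nested square roots make its fourth power [Num.sqrt x], the
    quantity in the theorem. *)
Definition root8 (R : realType) (x : R) : R := Num.sqrt (Num.sqrt (Num.sqrt x)).

Lemma root8_pow4 (R : realType) (x : R) : root8 x ^+ 4 = Num.sqrt x.
Proof. by rewrite (exprM _ 2 2) !sqr_sqrtr ?sqrtr_ge0. Qed.

Lemma root8_pow8 (R : realType) (x : R) : 0 <= x -> root8 x ^+ 8 = x.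
Proof. by move=> x0; rewrite (exprM _ 4 2) root8_pow4 sqr_sqrtr. Qed.

(** Multiplying m^3 <= ln p by m gives m^4 <= u^8, that is m <= u^2; and u is unbounded since u^8 >=
    ln p. *)
Lemma root8_near (R : realType) (p m : nat -> nat) (u0 : R) :
  p @ \oo --> \oo -> (forall n, 2 <= m (p n) <= p n)%N -> assumption2 R p m ->
  \forall n \near \oo,
    u0 <= root8 ((m (p n))%:R * ln (p n)%:R) /\
    (m (p n))%:R <= root8 ((m (p n))%:R * ln (p n)%:R) ^+ 2 :> R.
Proof.
move=> p_infty mp asm; near=> n.
set u := root8 _.
have m3 : (m (p n))%:R ^+ 3 <= ln (p n)%:R :> R.
  by near: n; exact: assumption2_cube_le.
have L0 : `|u0| ^+ 8 <= ln (p n)%:R by near: n; exact: near_ln_ge.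
have m1 : 1 <= (m (p n))%:R :> R.
  by have /andP[h _] := mp n; rewrite ler1n (leq_trans _ h).
have u_ge0 : 0 <= u by exact: sqrtr_ge0.
have L_ge0 : 0 <= ln (p n)%:R :> R by apply: le_trans L0; rewrite exprn_ge0.
have u8 : u ^+ 8 = (m (p n))%:R * ln (p n)%:R by rewrite root8_pow8// mulr_ge0.
split.
  apply: (le_trans (ler_norm u0)); rewrite -(@ler_pXn2r _ 8)// ?nnegrE// u8.
  by apply: (le_trans L0); rewrite ler_peMl.
rewrite -(@ler_pXn2r _ 4)// ?nnegrE ?exprn_ge0// -exprM u8 exprS.
by apply: ler_wpM2l => //; exact: le_trans ler01 m1.
Unshelve. all: by end_near. Qed.

Theorem mainTheorem4 (R : realType) (p m : nat -> nat)
  (d : nat -> measure_display) (Omega : forall n, measurableType (d n))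
  (P : forall n, probability (Omega n) R)
  (W : forall n, 'I_(p n) -> 'I_(p n) -> {RV (P n) >-> R})
  (p_infty : p @ \oo --> \oo)
  (m_bounds : forall n, (2 <= m (p n) <= p n)%N)
  (W_wigner : forall n, gaussian_wigner (W n))
  (m_assumption2 : assumption2 R p m) :
  let T : forall n, Omega n -> R :=
    fun n w => max_lambda (m (p n)) (random_mx (W n) w) in
  let V : forall n, Omega n -> R :=
    fun n w => min_lambda (m (p n)) (random_mx (W n) w) in
  let Z : forall n, Omega n -> R :=
    fun n w => V n w + 2 * Num.sqrt ((m (p n))%:R * ln (p n)%:R) in
  [/\ forall n, same_distribution (P n) (fun w => - T n w) (V n),
      cvg_in_probability0 P Z
    & forall alpha delta : R, 0 < alpha -> 0 < delta ->
        ('E_(P n)[fun w => (expR (alpha * `|Z n w|) *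
                           \1_[set w | delta <= `|Z n w|] w)%R])%E
          @[n --> \oo] --> 0%E].
Proof.
move=> T V Z.
have mp0 n : (0 < m (p n) <= p n)%N.
  by have /andP[h1 h2] := m_bounds n; rewrite h2 andbT (leq_trans _ h1).
pose u n : R := root8 ((m (p n))%:R * ln (p n)%:R).
have ln_ge0' n : 0 <= ln (p n)%:R :> R.
  apply: ln_ge0; rewrite ler1n; have /andP[h1 h2] := mp0 n.
  exact: leq_trans h1 h2.
have u8 n : (m (p n))%:R * ln (p n)%:R = u n ^+ 8 by rewrite root8_pow8// mulr_ge0.
(* The minimum for W is minus the maximum for - W, which is again a Gaussian Wigner matrix: all
   bounds are applied to - W. *)
pose t n w := top_lambda (m (p n)) (random_mx (fun i j => opp_rv (W n i j)) w).
have ZE n : Z n = fun w => 2 * u n ^+ 4 - t n w.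
  apply/funext => w.
  by rewrite /Z /V min_lambda_opp -random_mx_opp addrC /u root8_pow4.
have mZ n : measurable_fun setT (Z n).
  rewrite ZE; apply: measurable_funB; first exact: measurable_cst.
  by apply: measurable_fun_top_lambda; [exact: mp0|exact: gaussian_wigner_opp].
have mA n (e : R) : measurable [set w | e <= `|Z n w|].
  have mN : measurable_fun setT (fun w => `|Z n w|) by exact: measurableT_comp.
  rewrite -[X in measurable X]setTI
    (_ : [set w | _] = (fun w => `|Z n w|) @^-1` `[e, +oo[%classic).
    by apply: mN => //; exact: measurable_itv.
  by apply/seteqP; split=> w /=; rewrite in_itv/= andbT.
have bound (alpha delta : R) : 0 < alpha -> 0 < delta -> forall e : R, 0 < e ->
    \forall n \near \oo, (\int[P n]_w (expR (alpha * `|Z n w|) *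
      \1_[set w | (delta <= `|Z n w|)%R] w)%:E <= e%:E)%E.
  move=> a0 d0 e e0; have [u0 U] := wigner_deviation_bound a0 d0.
  near=> n.
  have [un mu] : `|u0| + 4 / e <= u n /\ (m (p n))%:R <= u n ^+ 2.
    by near: n; exact: root8_near.
  have e4 : 0 < 4 / e by rewrite divr_gt0.
  have un0 : u0 <= u n by have := ler_norm u0; lra.
  have un4 : 4 / e <= u n by have := normr_ge0 u0; lra.
  have u_gt0 : 0 < u n by lra.
  have {}U := U (u n) un0 _ _ (P n) _ _ _ (gaussian_wigner_opp (W_wigner n))
    (mp0 n) mu (u8 n).
  rewrite ZE; apply: (le_trans U).
  by rewrite lee_fin ler_pdivrMr// mulrC -ler_pdivrMr.
split.
- by move=> n; exact: (same_distribution_extreme (mp0 n) (W_wigner n)).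
- move=> delta d0; apply: cvge0_of_near_le; first by move=> n; exact: measure_ge0.
  (* Any positive slope would do: e^(alpha |Z|) >= 1, so the truncated exponential moment dominates
     the probability. *)
  move=> e e0; have := bound 1 delta ltr01 d0 e e0; apply: filterS => n.
  apply: le_trans.
  rewrite -[X in P n X]setIT -integral_indic//; apply: ge0_le_integral => //.
  + exact/measurable_EFinP/measurable_indic.
  + apply/measurable_EFinP; apply: measurable_funM; last exact: measurable_indic.
    apply/measurable_EFinP/measurable_expR_scale.
    exact: measurableT_comp.
  + move=> w _; rewrite lee_fin; apply: ler_peMl => //.
    by rewrite mul1r; apply: le_trans (expR_ge1Dx _); rewrite lerDl.
- move=> alpha delta a0 d0; apply: cvge0_of_near_le.
    move=> n; rewrite unlock; apply: integral_ge0 => w _.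
    by rewrite lee_fin mulr_ge0// expR_ge0.
  move=> e e0; have := bound alpha delta a0 d0 e e0; apply: filterS => n.
  by rewrite unlock.
Unshelve. all: by end_near. Qed.
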